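(* Let $d\ge 1$ and let $h$ be an increasing transformation with limit points $y_0<y_\infty$ such that: (i) $h(y)=o(|y|^{-\alpha})$ as $y\to-\infty$ for some $\alpha>d$; (ii) if $y_\infty<+\infty$, then $h(y)\asymp (y_\infty-y)^{-\beta}$ as $y\uparrow y_\infty$ for some $\beta>d$; (iii) $h$ is continuously differentiable on $(y_0,y_\infty)$. Let $X_1,\dots,X_n$ be i.i.d. with a density $p_0=h\circ g_0\in\mathcal P(h)$. Then, almost surely, the maximum likelihood estimator $\hat p_n=h\circ\hat g_n$ over the increasing model $\mathcal P(h)$ exists, i.e. almost surely there is $\hat g_n\in\mathcal G(h)$ maximizing $\mathbb L_n g=\frac1n\sum_{i=1}^n\log h(g(X_i))$ over $g\in\mathcal G(h)$.
   Context: Write $\overline{\mathbb R}=[-\infty,+\infty]$. An increasing transformation is a nondecreasing function $h:\overline{\mathbb R}\to[0,+\infty]$ with $h(-\infty)=0$ and $h(+\infty)=+\infty$. Its limit points are $y_0=\inf\{y:h(y)>0\}$ and $y_\infty=\sup\{y:h(y)<+\infty\}$, with $y_0<y_\infty$. The notation $a\asymp b$ means that $a/b$ is bounded above and bounded away from $0$ in the indicated limit. For an increasing transformation $h$, the increasing model $\mathcal P(h)$ is the family of all bounded probability densities (with respect to Lebesgue measure) on $[0,\infty)^d$ of the form $h\circ g$, where $g$ is a closed proper convex function with $\operatorname{dom} g=[0,\infty)^d$. $\mathcal G(h)$ denotes the class of all such closed proper convex functions $g$, i.e. with $h\circ g\in\mathcal P(h)$.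
   Formalization: The formal theorem also assumes that h is continuous at y_0 and y_∞ (no jump at a finite y_0; h(y)→+∞ as y→+∞ if y_∞=+∞); without this a maximizer may fail to exist, e.g. d=n=1, h(y)=e^y/(1+e^y), X_1<1/2. *)

(* Defs.v *)
From HB Require Import structures.
From mathcomp Require Import all_boot all_order all_algebra.
From mathcomp Require Import all_classical all_reals all_analysis.
From mathcomp Require Import measurable_realfun.

Set Implicit Arguments.
Unset Strict Implicit.
Unset Printing Implicit Defensive.

Import Order.TTheory GRing.Theory Num.Theory.
Import numFieldNormedType.Exports.

Local Open Scope classical_set_scope.
Local Open Scope ring_scope.

(* 'rV[R]_d carries the sigma-algebra generated by the coordinates, as
   d.-tuple R does in the library; this is the Borel sigma-algebra. *)
Definition rV_display : measure_display -> measure_display.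
Proof. exact. Qed.

Section measurable_rV.
Context {R : realType} {d : nat}.

Let coor (i : 'I_d) (x : 'rV[R]_d) : measurableTypeR R := x ord0 i.

Let rV_set0 : g_sigma_preimage coor set0.
Proof. exact: sigma_algebra0. Qed.

Let rV_setC A : g_sigma_preimage coor A -> g_sigma_preimage coor (~` A).
Proof. exact: sigma_algebraC. Qed.

Let rV_bigcup (F : _^nat) : (forall i, g_sigma_preimage coor (F i)) ->
  g_sigma_preimage coor (\bigcup_i (F i)).
Proof. exact: sigma_algebra_bigcup. Qed.

HB.instance Definition _ :=
  @isMeasurable.Build (rV_display default_measure_display)
    'rV[R]_d (g_sigma_preimage coor) rV_set0 rV_setC rV_bigcup.

End measurable_rV.

Lemma measurable_coord (R : realType) (d : nat) (i : 'I_d) :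
  measurable_fun [set: 'rV[R]_d] (fun x : 'rV[R]_d => x ord0 i).
Proof.
move=> _ Y mY; rewrite setTI; apply: sub_sigma_algebra => /=.
rewrite -bigcup_seq/=; exists i => /=; first by rewrite mem_index_enum.
by exists Y => //; rewrite setTI.
Qed.

Lemma measurable_fun_rVP (R : realType) (disp : measure_display)
    (T : measurableType disp) (d : nat) (f : T -> 'rV[R]_d) :
  (forall i, measurable_fun setT (fun t => f t ord0 i)) ->
  measurable_fun setT f.
Proof.
move=> mf.
suff : g_sigma_preimage (fun i (x : 'rV[R]_d) => (x ord0 i : measurableTypeR R))
    `<=` [set A | measurable (f @^-1` A)].
  by move=> sub _ A mA; rewrite setTI; exact: sub.
apply: smallest_sub.
  split => /=.
  - by rewrite preimage_set0.
  - by move=> A mA; rewrite setTD preimage_setC; exact: measurableC.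
  - by move=> F mF; rewrite preimage_bigcup; exact: bigcup_measurable.
case: d f mf => [|d] f mf; first by rewrite big_ord0.
rewrite -bigcup_mkord_ord; apply: bigcup_sub => i Ii A [B mB <-] /=.
by have := mf (inord i) measurableT B mB; rewrite setTI /= setTI.
Qed.

Section lebesgue_rV.
Context {R : realType}.
Local Open Scope ereal_scope.

Definition cons_rV d (p : measurableTypeR R * 'rV[R]_d) : 'rV[R]_d.+1 :=
  row_mx (p.1)%:M p.2.

Definition uncons_rV d (x : 'rV[R]_d.+1) : measurableTypeR R * 'rV[R]_d :=
  (x ord0 ord0, \row_i x ord0 (lift ord0 i)).

Lemma cons_rVK d : cancel (@cons_rV d) (@uncons_rV d).
Proof.
move=> [a v]; rewrite /uncons_rV /cons_rV /=; congr pair.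
  have -> : ord0 = lshift d (ord0 : 'I_1) by exact/val_inj.
  by rewrite (row_mxEl (a%:M)) mxE.
apply/rowP => i; rewrite mxE.
have -> : lift ord0 i = rshift 1 i by exact/val_inj.
by rewrite (row_mxEr (a%:M)).
Qed.

Lemma measurable_cons_rV d : measurable_fun setT (@cons_rV d).
Proof.
apply: measurable_fun_rVP => i; case: (unliftP ord0 i) => [j|] ->.
  rewrite (_ : (fun _ => _) = (fun x : 'rV[R]_d => x ord0 j) \o snd).
    by apply: measurableT_comp => //; exact: measurable_coord.
  apply/funext => p /=.
  by have := congr1 snd (cons_rVK p) => /= /rowP/(_ j); rewrite mxE.
rewrite (_ : (fun _ => _) = fst) //.
by apply/funext => p; exact: (congr1 fst (cons_rVK p)).
Qed.

Lemma measurable_uncons_rV d : measurable_fun setT (@uncons_rV d).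
Proof.
apply/measurable_fun_pairP; split => /=; first exact: measurable_coord.
apply: measurable_fun_rVP => i.
rewrite (_ : (fun _ => _) = (fun x : 'rV[R]_d.+1 => x ord0 (lift ord0 i))).
  exact: measurable_coord.
by apply/funext => x; rewrite /= mxE.
Qed.

Section step.
Variables (d : nat) (m : {sigma_finite_measure set 'rV[R]_d -> \bar R}).

Definition lebesgue_cons : set 'rV[R]_d.+1 -> \bar R :=
  pushforward (lebesgue_measure \x m) (@cons_rV d).

Let pushforward_cons : {measure set 'rV[R]_d.+1 -> \bar R} :=
  measure_function_pushforward__canonical__measure_function_Measure
    (lebesgue_measure \x m) (@measurable_cons_rV d).

Let lebesgue_cons0 : lebesgue_cons set0 = 0.
Proof. exact: (measure0 pushforward_cons). Qed.

Let lebesgue_cons_ge0 A : 0 <= lebesgue_cons A.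
Proof. exact: (measure_ge0 pushforward_cons). Qed.

Let lebesgue_cons_sigma_additive : semi_sigma_additive lebesgue_cons.
Proof. exact: (@measure_semi_sigma_additive _ _ _ pushforward_cons). Qed.

HB.instance Definition _ := isMeasure.Build _ _ _ lebesgue_cons
  lebesgue_cons0 lebesgue_cons_ge0 lebesgue_cons_sigma_additive.

Let lebesgue_cons_sigma_finite : sigma_finite setT lebesgue_cons.
Proof.
have /sigma_finiteP[F [TF ndF Foo]] :=
  sigma_finiteT (@lebesgue_measure R).
have /sigma_finiteP[G [TG ndG Goo]] := sigma_finiteT m.
exists (fun n => @uncons_rV d @^-1` (F n `*` G n)).
  apply/seteqP; split => // x _.
  have [n _ Fn] : (\bigcup_i F i) (uncons_rV x).1 by rewrite -TF.
  have [k _ Gk] : (\bigcup_i G i) (uncons_rV x).2 by rewrite -TG.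
  exists (maxn n k) => //; split.
  - by move: Fn; exact/subsetPset/ndF/leq_maxl.
  - by move: Gk; exact/subsetPset/ndG/leq_maxr.
move=> n; have [mFn Fn] := Foo n; have [mGn Gn] := Goo n; split.
  rewrite -[X in measurable X]setTI; apply: measurable_uncons_rV => //.
  exact: measurableX.
rewrite /lebesgue_cons /pushforward -comp_preimage.
rewrite (_ : _ \o _ = id); last by apply/funext => p /=; rewrite cons_rVK.
rewrite preimage_id (product_measure1E lebesgue_measure m mFn mGn).
by rewrite lte_mul_pinfty// ge0_fin_numE.
Qed.

HB.instance Definition _ :=
  Measure_isSigmaFinite.Build _ _ _ lebesgue_cons lebesgue_cons_sigma_finite.

End step.

(* Lebesgue measure on R^d, by R^(d+1) = R x R^d. *)
Fixpoint lebesgue_rV (d : nat) :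
    {sigma_finite_measure set 'rV[R]_d -> \bar R} :=
  if d is d'.+1 then lebesgue_cons (lebesgue_rV d') else \d_(0%R : 'rV[R]_0).

Lemma lebesgue_rV_box (d : nat) (a b : 'rV[R]_d) :
  (forall i, (a ord0 i <= b ord0 i)%R) ->
  lebesgue_rV d [set x | forall i, (a ord0 i <= x ord0 i <= b ord0 i)%R] =
  \prod_(i < d) (b ord0 i - a ord0 i)%:E.
Proof.
elim: d a b => [|d IH] a b ab /=.
  by rewrite big_ord0 diracE mem_set // => -[].
pose a' := (uncons_rV a).2; pose b' := (uncons_rV b).2.
have mB : measurable [set x : 'rV[R]_d |
    forall i, (a' ord0 i <= x ord0 i <= b' ord0 i)%R].
  rewrite (_ : [set x | _] = \bigcap_(i in [set: 'I_d])
      ((fun x : 'rV[R]_d => x ord0 i) @^-1` `[a' ord0 i, b' ord0 i])).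
    apply: fin_bigcap_measurable => // i _.
    by rewrite -[X in measurable X]setTI; exact: measurable_coord.
  apply/seteqP; split => x /= H i; first by move=> _ /=; rewrite in_itv /= H.
  by have := H i I; rewrite /= in_itv.
rewrite /lebesgue_cons /pushforward.
rewrite (_ : _ @^-1` _ = `[a ord0 ord0, b ord0 ord0]%classic `*`
    [set x : 'rV[R]_d | forall i, (a' ord0 i <= x ord0 i <= b' ord0 i)%R]);
  last first.
  have E (p : measurableTypeR R * 'rV[R]_d) : cons_rV p ord0 ord0 = p.1.
    exact: (congr1 fst (cons_rVK p)).
  have E' (p : measurableTypeR R * 'rV[R]_d) i :
      cons_rV p ord0 (lift ord0 i) = p.2 ord0 i.
    by have := congr1 snd (cons_rVK p) => /= /rowP/(_ i); rewrite mxE.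
  apply/seteqP; split => p /=.
    move=> H; split; first by have := H ord0; rewrite E in_itv.
    by move=> i; have := H (lift ord0 i); rewrite E' !mxE.
  move=> [+ H] i; rewrite in_itv /= => H0.
  case: (unliftP ord0 i) => [j|] ->; last by rewrite E.
  by have := H j; rewrite E' !mxE.
rewrite (product_measure1E lebesgue_measure (lebesgue_rV d)) //.
rewrite IH; last by move=> i; rewrite !mxE.
rewrite big_ord_recl; congr (_ * _); last first.
  by apply: eq_bigr => i _; rewrite !mxE.
apply: (etrans (lebesgue_measure_itv `[a ord0 ord0, b ord0 ord0])).
rewrite /= lte_fin; case: ltP => // ba.
by rewrite (_ : a ord0 ord0 = b ord0 ord0) ?subrr //; apply/eqP; rewrite eq_le ab ba.
Qed.

End lebesgue_rV.

Section convex_functions.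
Context {R : realType} {d : nat}.
Local Open Scope ereal_scope.
Implicit Types g : 'rV[R]_d -> \bar R.

Definition effective_domain g : set 'rV[R]_d := [set x | g x < +oo].

Definition proper g := (forall x, -oo < g x) /\ effective_domain g !=set0.

(* The right-hand side is never of the form +oo - oo when [g] is proper. *)
Definition convex_efun g := forall (x y : 'rV[R]_d) (t : R),
  (0 < t < 1)%R ->
  g (t *: x + (1 - t) *: y)%R <= t%:E * g x + (1 - t)%:E * g y.

(* A proper convex function is closed iff it is lower semicontinuous. *)
Definition closed_proper_convex g :=
  [/\ convex_efun g, proper g & lower_semicontinuous g].

Definition orthant : set 'rV[R]_d := [set x | forall i, (0 <= x ord0 i)%R].

End convex_functions.
Arguments orthant R d : clear implicits.

Section transformations.
Context {R : realType}.
Local Open Scope ereal_scope.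
Implicit Types h : \bar R -> \bar R.

Definition increasing_transformation h :=
  [/\ {homo h : x y / x <= y}, forall y, 0 <= h y, h -oo = 0 & h +oo = +oo].

Definition y_zero h : \bar R := ereal_inf [set y | 0 < h y].
Definition y_infty h : \bar R := ereal_sup [set y | h y < +oo].

(* [h] reaches its limits 0 and +oo without a jump. A jump is compatible with
   monotonicity, h(-oo) = 0 and h(+oo) = +oo, but then a maximum likelihood
   estimator may fail to exist: with d = 1 this happens for n = 1 and
   h(y) = e^y / (1 + e^y) on R, since a likelihood of 1 is approached but not
   reached when X_1 < 1/2, and for n = 2 and h(y) = (1 + y) 1_{y > 0} on R,
   when X_1 is close to 0 and X_2 to 9/10. *)
Definition continuous_at_limit_points h :=
  {for y_zero h, continuous h} /\ {for y_infty h, continuous h}.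

(* [h] is finite at the reals below [y_infty h], the only ones that matter. *)
Definition real_part h : R -> R := fun y => fine (h y%:E).

Definition asymp (F : set_system R) (a b : R -> R) :=
  exists c C : R, (0 < c)%R /\ \forall y \near F, (c <= a y / b y <= C)%R.

End transformations.

Section increasing_model.
Context {R : realType} {d : nat}.
Local Open Scope ereal_scope.
Implicit Types (h : \bar R -> \bar R) (g : 'rV[R]_d -> \bar R).

(* [h \o g] on the orthant, extended by 0: outside it g = +oo and h \o g = +oo. *)
Definition transformed h g : 'rV[R]_d -> \bar R := (h \o g) \_ (orthant R d).

Definition bounded_density (p : 'rV[R]_d -> \bar R) :=
  [/\ measurable_fun [set: 'rV[R]_d] p, forall x, 0 <= p x,
      exists M : R, forall x, p x <= M%:E
    & \int[lebesgue_rV d]_x p x = 1].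

Definition convex_on_orthant : set ('rV[R]_d -> \bar R) :=
  [set g | closed_proper_convex g /\ effective_domain g = orthant R d].

Definition increasing_model h : set ('rV[R]_d -> \bar R) :=
  [set p | bounded_density p /\
    exists2 g, convex_on_orthant g & p = transformed h g].

Definition model_functions h : set ('rV[R]_d -> \bar R) :=
  [set g | convex_on_orthant g /\ increasing_model h (transformed h g)].

Definition log_likelihood h n (x : 'I_n -> 'rV[R]_d) g : \bar R :=
  (n%:R^-1)%:E * \sum_(i < n) lne (h (g (x i))).

Definition is_mle h n (x : 'I_n -> 'rV[R]_d) g :=
  model_functions h g /\
  forall g', model_functions h g' ->
    log_likelihood h x g' <= log_likelihood h x g.

End increasing_model.

Section sampling.
Context {R : realType} {d : nat} {disp : measure_display}
  {T : measurableType disp} (P : probability T R).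
Local Open Scope ereal_scope.

Definition has_density (X : {RV P >-> 'rV[R]_d}) (p : 'rV[R]_d -> \bar R) :=
  forall A, measurable A -> P (X @^-1` A) = \int[lebesgue_rV d]_(x in A) p x.

(* The product rule for subfamilies follows by taking [A i = setT]. *)
Definition mutually_independent n (X : 'I_n -> {RV P >-> 'rV[R]_d}) :=
  forall A : 'I_n -> set 'rV[R]_d, (forall i, measurable (A i)) ->
    P (\bigcap_(i in setT) (X i @^-1` A i)) = \prod_(i < n) P (X i @^-1` A i).

Definition iid_with_density n (X : 'I_n -> {RV P >-> 'rV[R]_d})
    (p : 'rV[R]_d -> \bar R) :=
  mutually_independent X /\ forall i, has_density (X i) p.

End sampling.

(* Main.v *)
Require Import Defs.
From HB Require Import structures.
From mathcomp Require Import all_boot all_order all_algebra.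
From mathcomp Require Import all_classical all_reals all_analysis.
From mathcomp Require Import measurable_realfun.
From mathcomp Require Import ring lra.

Set Implicit Arguments.
Unset Strict Implicit.
Unset Printing Implicit Defensive.

Import Order.TTheory GRing.Theory Num.Theory.
Import numFieldNormedType.Exports.

Local Open Scope classical_set_scope.
Local Open Scope ring_scope.

(* A density of the model decreases in every coordinate, so its value at an
   observation x is at most 1 / (x_1 ... x_d). Replacing a model function g by
   the maximum of its tangent affine functions at the observations keeps the
   likelihood and can only decrease the integral of h o g, so the supremum of
   the likelihood may be computed over maxima of n affine functions whose
   transformed mass is at most 1. Comparing masses with volumes of boxes bounds
   the values and slopes of these affine functions, and by Fatou's lemma the
   mass constraint is closed: a maximizer t exists. Finally the maximum of
   affine functions given by t is raised by a constant c >= 0, which does not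
   decrease the likelihood, until its mass is 1. Such a c exists by the
   intermediate value theorem: the decay of h at -oo with alpha > d makes the
   mass finite and continuous in c, and the blow-up of h at y_oo with beta > d
   makes it exceed 1. *)

(** * Subgradients *)

Section sublinear.
Context {R : realType} {V : lmodType R}.
Implicit Types (p : V -> R) (v w e : V).

(** Scaling is an inequality for positive factors only; applying it to the inverse factor gives
    equality in [sublinearZ]. *)
Definition sublinear p :=
  (forall v w, p (v + w) <= p v + p w) /\
  (forall (c : R) v, 0 < c -> p (c *: v) <= c * p v).

Lemma lb_inf_add (A B : set R) (z : R) : A !=set0 -> B !=set0 ->
  (forall a b, A a -> B b -> z <= a + b) -> z <= inf A + inf B.
Proof.
move=> A0 B0 H; rewrite -lerBlDr; apply: lb_le_inf => // a Aa.
rewrite lerBlDr addrC -lerBlDr; apply: lb_le_inf => // b Bb.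
by rewrite lerBlDr addrC H.
Qed.

Lemma sublinearZ p (c : R) v : sublinear p -> 0 < c -> p (c *: v) = c * p v.
Proof.
move=> [_ pZ] c0; apply/eqP; rewrite eq_le pZ//=.
have := pZ c^-1 (c *: v); rewrite invr_gt0 => /(_ c0).
by rewrite scalerA mulVf ?gt_eqF// scale1r ler_pdivlMl.
Qed.

Lemma sublinear0 p : sublinear p -> p 0 = 0.
Proof. by move=> ps; have := sublinearZ 0 ps (ltr0n R 2); rewrite scaler0; lra. Qed.

Lemma sublinear_ge_oppr p v : sublinear p -> 0 <= p v + p (- v).
Proof.
by move=> ps; rewrite -(sublinear0 ps) -(subrr v); case: ps => + _; apply.
Qed.

(* A Zorn-free Hahn-Banach step: once [p] has been made linear along every
   vector of a basis, it is linear. *)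
Lemma sublinear_straighten p e : sublinear p ->
  exists q, [/\ sublinear q, (forall v, q v <= p v) & q (- e) = - q e].
Proof.
move=> ps; have [pD pZ] := ps; have p0 := sublinear0 ps.
(* At [- e], the choice [t = 1] gives the value [- p e]; hence the infimum there is at most [- p e],
   which forces oddness along [e]. *)
pose S v := [set p (v + t *: e) - t * p e | t in [set t : R | 0 <= t]].
have Sn v : S v !=set0 by exists (p (v + 0 *: e) - 0 * p e), 0 => /=.
have Slb v : has_lbound (S v).
  exists (- p (- v)) => _ [t /= t0 <-].
  have -> : t * p e = p (t *: e).
    have [->|t1] := eqVneq t 0; first by rewrite mul0r scale0r.
    by rewrite sublinearZ// lt_neqAle eq_sym t1.
  by have := pD (- v) (v + t *: e); rewrite addKr; lra.
have Sle v t : 0 <= t -> inf (S v) <= p (v + t *: e) - t * p e.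
  by move=> t0; apply: ge_inf => //; exists t.
have qp v : inf (S v) <= p v.
  by have := Sle v 0 (lexx 0); rewrite scale0r addr0 mul0r subr0.
have qs : sublinear (fun v => inf (S v)).
  split=> [v w|c v c0].
    apply: lb_inf_add => // _ _ [t /= t0 <-] [s /= s0 <-].
    apply: (le_trans (Sle _ (t + s) (addr_ge0 t0 s0))).
    have := pD (v + t *: e) (w + s *: e).
    by rewrite scalerDl addrACA mulrDl; lra.
  rewrite -ler_pdivrMl//; apply: lb_le_inf => // _ [t /= t0 <-].
  rewrite ler_pdivrMl//; apply: (le_trans (Sle _ (c * t) _)).
    by rewrite mulr_ge0// ltW.
  by rewrite -scalerA -scalerDr mulrBr mulrA lerB// pZ.
exists (fun v => inf (S v)); split => //.
have := sublinear_ge_oppr e qs.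
have := Sle (- e) 1 ler01; rewrite scale1r addNr p0 mul1r.
by have := qp e; lra.
Qed.

Lemma sublinear_straighten_seq p (s : seq V) : sublinear p ->
  exists q, [/\ sublinear q, (forall v, q v <= p v) &
    forall e, e \in s -> q (- e) = - q e].
Proof.
elim: s p => [|e s IH] p ps; first by exists p; split.
have [q [qs qp qe]] := sublinear_straighten e ps.
have [r [rs rq re]] := IH q qs.
exists r; split => //; first by move=> v; exact: (le_trans (rq v)).
move=> f; rewrite inE => /orP[/eqP ->|/re//].
(* Later steps keep the oddness at [e]: [r <= q] gives [r e + r (- e) <= 0], and sublinearity gives
   the reverse inequality. *)
have := sublinear_ge_oppr e rs.
by have := rq e; have := rq (- e); rewrite qe; lra.
Qed.

End sublinear.

(** Once [q] is odd at the basis vectors, it lies below the linear form with coefficients [q (e j)].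
    Applied to [- v], the same bound shows that [q] also lies above it. *)
Lemma sublinear_minorant (R : realType) d (p : 'rV[R]_d -> R) : sublinear p ->
  exists a : 'rV[R]_d, forall v : 'rV[R]_d, \sum_j a ord0 j * v ord0 j <= p v.
Proof.
move=> ps; pose e j : 'rV[R]_d := delta_mx ord0 j.
have [q [qs qp qe]] := sublinear_straighten_seq [seq e j | j : 'I_d] ps.
have qe' j : q (- e j) = - q (e j) by apply: qe; apply/mapP; exists j; rewrite ?mem_enum.
have qZ (c : R) j : q (c *: e j) = c * q (e j).
  have [c0|c0|->] := ltrgtP c 0; last by rewrite scale0r mul0r sublinear0.
  - by rewrite -(opprK c) scaleNr -scalerN sublinearZ ?oppr_gt0// qe'; lra.
  - by rewrite sublinearZ.
have qsum v : q v <= \sum_j q (e j) * v ord0 j.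
  rewrite {1}(row_sum_delta v).
  elim/big_ind2 : _ => //=; first by rewrite sublinear0.
  - by move=> x1 x2 y1 y2 H1 H2; apply: (le_trans (qs.1 _ _)); exact: lerD.
  - by move=> j _; rewrite qZ mulrC.
exists (\row_j q (e j)) => v; under eq_bigr do rewrite mxE.
apply: le_trans (qp v).
have := sublinear_ge_oppr v qs; have := qsum (- v).
rewrite (eq_bigr (fun j => - (q (e j) * v ord0 j))); last first.
  by move=> j _; rewrite mxE mulrN.
by rewrite sumrN; lra.
Qed.

Section subgradient.
Context {R : realType} {d : nat}.
Variable g : 'rV[R]_d -> \bar R.
Hypothesis g_convex : convex_on_orthant g.

Lemma orthant_fin_num x : orthant R d x -> g x \is a fin_num.
Proof.
case: g_convex => -[_ [gNy _] _] domg Ox.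
rewrite fin_numElt gNy/=; by move: Ox; rewrite -domg.
Qed.

Lemma orthant_convexW (x y : 'rV[R]_d) (s t : R) : 0 <= s -> 0 <= t ->
  orthant R d x -> orthant R d y -> orthant R d (s *: x + t *: y).
Proof. by move=> s0 t0 Ox Oy i; rewrite !mxE addr_ge0// mulr_ge0. Qed.

Lemma fine_convex (x y : 'rV[R]_d) (t : R) : 0 < t < 1 ->
  orthant R d x -> orthant R d y ->
  fine (g (t *: x + (1 - t) *: y)) <= t * fine (g x) + (1 - t) * fine (g y).
Proof.
move=> t01 Ox Oy; case: (g_convex) => -[gc _ _] _.
have := gc x y t t01.
have Oxy : orthant R d (t *: x + (1 - t) *: y).
  by case/andP: t01 => t0 t1; apply: orthant_convexW => //; lra.
rewrite -(fineK (orthant_fin_num Oxy)) -(fineK (orthant_fin_num Ox)).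
by rewrite -(fineK (orthant_fin_num Oy)) -!EFinM -EFinD lee_fin.
Qed.

(** The infimum of the difference quotients at [x] is the directional derivative. It is finite
    because [x] is interior to the orthant, and sublinear by convexity; a linear minorant of it is a
    subgradient. *)
Lemma subgradient_exists (x : 'rV[R]_d) : (forall j, 0 < x ord0 j) ->
  exists a : 'rV[R]_d, forall z, orthant R d z ->
    ((fine (g x) - \sum_j a ord0 j * (z ord0 j - x ord0 j))%:E <= g z)%E.
Proof.
move=> x0; pose q v t := (fine (g (x + t *: v)) - fine (g x)) / t.
pose D v := [set t : R | 0 < t /\ orthant R d (x + t *: v)].
have Ox : orthant R d x by move=> j; exact: ltW.
have Dn v : D v !=set0.
  have [m m0 mx] : exists2 m : R, 0 < m & forall j, m <= x ord0 j.
    have : forall s : seq 'I_d, exists2 m : R, 0 < m &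
        forall j, j \in s -> m <= x ord0 j.
      elim=> [|i s [m m0 ms]]; first by exists 1.
      exists (Num.min (x ord0 i) m); first by rewrite lt_min x0.
      by move=> j; rewrite inE ge_min => /predU1P[->|/ms ->]; rewrite ?lexx ?orbT.
    by move=> /(_ (enum 'I_d))[m m0 ms]; exists m => // j; rewrite ms// mem_enum.
  (* Here [m] bounds all coordinates of [x] from below; the added 1 keeps the denominator positive
     when [v = 0]. *)
  exists (m / (1 + `|v|)); have v1 : 0 < 1 + `|v| by rewrite ltr_pwDl.
  split; first exact: divr_gt0.
  move=> j; rewrite !mxE.
  have : `|v ord0 j| <= `|v|.
    by rewrite /Num.norm/= mx_normrE (le_bigmax _ (fun i => `|v i.1 i.2|) (ord0, j)).
  rewrite ler_norml => /andP[vj _].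
  have : m / (1 + `|v|) * (- (1 + `|v|)) <= m / (1 + `|v|) * v ord0 j.
    by rewrite ler_pM2l ?divr_gt0//; lra.
  by rewrite mulrN divfK ?gt_eqF//; have := mx j; lra.
(* Difference quotients with steps [t] and [s] combine at the harmonic step
   [t * s / (t + s)], whose point is a convex combination of the two points. *)
have qD v w t s : D v t -> D w s ->
    exists2 u, D (v + w) u & q (v + w) u <= q v t + q w s.
  move=> [t0 Ot] [s0 Os]; have ts0 : 0 < t + s by exact: addr_gt0.
  have E : x + (t * s / (t + s)) *: (v + w) =
      (s / (t + s)) *: (x + t *: v) + (1 - s / (t + s)) *: (x + s *: w).
    apply/rowP => j; rewrite !mxE; field; exact: lt0r_neq0.
  have s1 : 0 < s / (t + s) < 1.
    by rewrite divr_gt0//= ltr_pdivrMr// mul1r; lra.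
  have u0 : 0 < t * s / (t + s) by rewrite divr_gt0// mulr_gt0.
  exists (t * s / (t + s)).
    split => //; rewrite E; case/andP: s1 => ? ?.
    by apply: orthant_convexW => //; lra.
  rewrite /q ler_pdivrMr// E.
  have := fine_convex s1 Ot Os.
  set A := fine (g (x + t *: v)); set B := fine (g (x + s *: w)).
  set C := fine (g x).
  suff -> : ((A - C) / t + (B - C) / s) * (t * s / (t + s)) =
    (s / (t + s)) * A + (1 - s / (t + s)) * B - C by lra.
  by field; rewrite !lt0r_neq0.
pose S v := [set q v t | t in D v].
have Sn v : S v !=set0 by case: (Dn v) => t Dt; exists (q v t), t.
have Slb v : has_lbound (S v).
  (* Quotients in the direction 0 vanish, so combining [v] with [- v] bounds all quotients along [v]
     from below. *)
  have [s Ds] := Dn (- v); exists (- q (- v) s) => _ [t Dt <-].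
  have [u [u0 _]] := qD _ _ _ _ Dt Ds.
  by rewrite {1}/q subrr scaler0 addr0 subrr mul0r; lra.
have Sle v t : D v t -> inf (S v) <= q v t.
  by move=> Dt; apply: ge_inf => //; exists t.
have ps : sublinear (fun v => inf (S v)).
  split=> [v w|c v c0].
    apply: lb_inf_add => // _ _ [t Dt <-] [s Ds <-].
    by have [u Du] := qD _ _ _ _ Dt Ds; exact/le_trans/Sle.
  rewrite -ler_pdivrMl//; apply: lb_le_inf => // _ [t [t0 Ot] <-].
  have E : (t / c) *: (c *: v) = t *: v by rewrite scalerA divfK ?gt_eqF.
  rewrite ler_pdivrMl//; apply: (le_trans (Sle _ (t / c) _)).
    by split; [exact: divr_gt0|rewrite E].
  by rewrite /q E invf_div mulrCA.
have [a ap] := sublinear_minorant ps.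
(* The sign changes because slopes are recorded as opposites of gradients. *)
exists (- a) => z Oz; rewrite -(fineK (orthant_fin_num Oz)) lee_fin.
have xzx : x + (z - x) = z by rewrite addrC subrK.
have D1 : D (z - x) 1 by split; rewrite // scale1r xzx.
have := le_trans (ap (z - x)) (Sle _ _ D1).
rewrite /q divr1 scale1r xzx.
under eq_bigr do rewrite !mxE.
under [X in _ -> _ - X <= _]eq_bigr do rewrite mxE mulNr.
by rewrite sumrN; lra.
Qed.

End subgradient.

(** * Lebesgue measure of boxes *)

Section boxes.
Context {R : realType} {d : nat}.
Implicit Types (a b x : 'rV[R]_d) (f : 'rV[R]_d -> \bar R).
Local Notation mu := (@lebesgue_rV R d).

Definition box a b : set 'rV[R]_d :=
  [set x | forall i, a ord0 i <= x ord0 i <= b ord0 i].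

Lemma measurable_rV_bigcap (A : 'I_d -> set R) :
  (forall i, measurable (A i)) ->
  measurable [set x : 'rV[R]_d | forall i, A i (x ord0 i)].
Proof.
move=> mA; rewrite (_ : [set x | _] = \bigcap_(i in [set: 'I_d])
    ((fun x : 'rV[R]_d => x ord0 i) @^-1` A i)); last first.
  by apply/seteqP; split => x /= H i; [move=> _; exact: H|exact: H].
apply: fin_bigcap_measurable => // i _.
by rewrite -[X in measurable X]setTI; exact: measurable_coord.
Qed.

Lemma measurable_box a b : measurable (box a b).
Proof.
rewrite (_ : box a b = [set x | forall i, `[a ord0 i, b ord0 i]%classic (x ord0 i)]).
  exact: (@measurable_rV_bigcap (fun i => `[a ord0 i, b ord0 i]%classic)).
by apply/seteqP; split => x /= H i; have := H i; rewrite /= in_itv.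
Qed.

Lemma measurable_orthant : measurable (orthant R d).
Proof.
rewrite (_ : orthant R d = [set x | forall i, `[0%R, +oo[%classic (x ord0 i)]).
  exact: (@measurable_rV_bigcap (fun=> `[0%R, +oo[%classic)).
by apply/seteqP; split => x /= H i; have := H i; rewrite /= in_itv/= andbT.
Qed.

Lemma box_measure a b : (forall i, a ord0 i <= b ord0 i) ->
  mu (box a b) = (\prod_(i < d) (b ord0 i - a ord0 i))%:E.
Proof. by move=> ab; rewrite lebesgue_rV_box// prodEFin. Qed.

Lemma box_integral_le f (c : R) a b :
  measurable_fun (orthant R d) f ->
  (forall x, orthant R d x -> (0 <= f x)%E) ->
  box a b `<=` orthant R d -> (forall i, a ord0 i <= b ord0 i) -> 0 <= c ->
  (forall x, box a b x -> (c%:E <= f x)%E) ->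
  ((c * \prod_(i < d) (b ord0 i - a ord0 i))%:E <=
   \int[mu]_(x in orthant R d) f x)%E.
Proof.
move=> mf f0 sub ab c0 cf.
have mB := measurable_box a b; have mO := measurable_orthant.
apply: (@le_trans _ _ (\int[mu]_(x in box a b) f x)%E); last first.
  exact: ge0_subset_integral.
rewrite EFinM -box_measure// -integral_cst//.
by apply: ge0_le_integral => //; exact: measurable_funS mf.
Qed.

(** The hyperplane is a countable union of boxes of width 0 in the direction [j]. *)
Lemma hyperplane_null (j : 'I_d) : mu.-negligible [set x : 'rV[R]_d | x ord0 j = 0].
Proof.
pose a k : 'rV[R]_d := \row_i (if i == j then 0 else - k%:R).
pose b k : 'rV[R]_d := \row_i (if i == j then 0 else k%:R).
apply: (@negligibleS _ _ _ mu (\bigcup_k box (a k) (b k))).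
  move=> x /= xj; pose k := (Num.bound `|x|); exists k => // i; rewrite !mxE.
  case: eqP => [->|_]; first by rewrite xj lexx.
  rewrite -ler_norml; apply: (@le_trans _ _ `|x|).
    by rewrite [leRHS]/Num.norm/= mx_normrE (le_bigmax _ (fun i => `|x i.1 i.2|) (ord0, i)).
  by rewrite ltW// (le_lt_trans _ (archi_boundP _))// ler_norm.
apply: negligible_bigcup => k; apply/negligibleP; first exact: measurable_box.
rewrite [LHS]box_measure; last first.
  by move=> i; rewrite !mxE; case: ifP => // _; rewrite lerNl (le_trans _ (ler0n R k))// oppr_le0 ler0n.
by rewrite (bigD1 j)//= !mxE eqxx subrr mul0r.
Qed.

(** The orthant is exhausted by the cubes of side [2 ^+ k]. On the shell outside the [k]-th cube the
    bound [m k] holds, so the shells contribute a convergent geometric series. *)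
Lemma dyadic_integral_lty f (m0 C r : R) (m : nat -> R) :
  measurable_fun (orthant R d) f ->
  (forall x, orthant R d x -> (0 <= f x)%E) ->
  (forall x, orthant R d x -> (f x <= m0%:E)%E) ->
  (forall k x, orthant R d x -> (exists j, 2 ^+ k < x ord0 j) ->
     (f x <= (m k)%:E)%E) ->
  0 <= r < 1 -> (forall k, 0 <= m k) ->
  (forall k, m k * (2 ^+ k.+1) ^+ d <= C * r ^+ k) ->
  (\int[mu]_(x in orthant R d) f x < +oo)%E.
Proof.
move=> mf f0 fm0 fm /andP[r0 r1] m_ge0 mC.
have C0 : 0 <= C.
  by rewrite -[C]mulr1 -(expr0 r) (le_trans _ (mC 0%N))// mulr_ge0 ?exprn_ge0.
pose B k := box 0 (const_mx (2 ^+ k)).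
have mB k : measurable (B k) by exact: measurable_box.
have BO k : B k `<=` orthant R d.
  by move=> x Bx j; have /andP[+ _] := Bx j; rewrite mxE.
have muB k : mu (B k) = ((2 ^+ k) ^+ d)%:E.
  rewrite [LHS]box_measure; last by move=> i; rewrite !mxE exprn_ge0.
  under eq_bigr do rewrite !mxE subr0.
  by rewrite big_const_ord iter_mulr_1.
have mfB k : measurable_fun (B k) f by apply: measurable_funS mf => //; exact: measurable_orthant.
have OB : orthant R d = \bigcup_k B k.
  apply/seteqP; split; last by move=> x [k _ /BO].
  move=> x Ox; exists (Num.bound `|x|) => // j; rewrite !mxE Ox/=.
  apply: (@le_trans _ _ `|x|).
    rewrite (le_trans (ler_norm _))//.
    by rewrite [leRHS]/Num.norm/= mx_normrE (le_bigmax _ (fun i => `|x i.1 i.2|) (ord0, j)).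
  rewrite ltW// (lt_le_trans (archi_boundP _))//.
  by rewrite -natrX ler_nat ltnW// ltn_expl.
have ndB : nondecreasing_seq B.
  apply/nondecreasing_seqP => k; rewrite subsetEset => x Bx j.
  have := Bx j; rewrite !mxE => /andP[-> /=]/le_trans; apply.
  by rewrite ler_weXn2l ?ler1n.
have m00 : 0 <= m0.
  by rewrite -lee_fin (le_trans (f0 0 _) (fm0 0 _))// => j; rewrite mxE.
(* The cube [B 0] contributes at most [m0]; the shell between [B k] and [B k.+1] adds at most
   [C * r ^+ k]. *)
have H k : (\int[mu]_(x in B k) f x <= (m0 + C * (1 - r ^+ k) / (1 - r))%:E)%E.
  elim: k => [|k IH].
    rewrite expr0 subrr mulr0 mul0r addr0.
    have -> : m0%:E = (m0%:E * mu (B 0%N))%E.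
      by rewrite muB expr0 expr1n mule1.
    rewrite -integral_cst//; apply: ge0_le_integral => //.
      by move=> x /BO; exact: f0.
    by move=> x /BO; exact: fm0.
  have sub : B k `<=` B k.+1 by rewrite -subsetEset; exact: ndB.
  have mD : measurable (B k.+1 `\` B k) by exact: measurableD.
  rewrite -(setDUK sub) ge0_integral_setU//; last 3 first.
  - by rewrite setDUK.
  - by rewrite setDUK// => x /BO; exact: f0.
  - by apply/disj_setPS => x [? []].
  have D : (\int[mu]_(x in B k.+1 `\` B k) f x <= (C * r ^+ k)%:E)%E.
    apply: (@le_trans _ _ (\int[mu]_(x in B k.+1 `\` B k) (cst (m k)%:E x))%E).
      apply: ge0_le_integral => //.
      - by move=> x [/BO Ox _]; exact: f0.
      - by apply: measurable_funS (mfB k.+1) => // x [].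
      move=> x [Bx nBx]; apply: fm; first exact: BO Bx.
      apply: contrapT => /forallNP H; apply: nBx => j.
      by rewrite !mxE (BO _ _ Bx)/=; have := H j; rewrite ltNge => /negP/negPn.
    rewrite integral_cst//.
    apply: (@le_trans _ _ ((m k)%:E * mu (B k.+1))%E).
      by apply: lee_wpmul2l; rewrite ?lee_fin// le_measure ?inE// => x [].
    by rewrite muB -EFinM lee_fin.
  apply: (le_trans (leeD IH D)); rewrite -EFinD lee_fin exprS.
  have r1' : 1 - r != 0 by rewrite subr_eq0 gt_eqF.
  by rewrite le_eqVlt; apply/orP; left; apply/eqP; field.
have := @ge0_nondecreasing_set_cvg_integral _ _ _ B f mu ndB mB mfB
  (fun k x Bx => f0 x (BO k x Bx)).
rewrite -OB => cvgI; rewrite -(cvg_lim _ cvgI)//.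
apply: (@le_lt_trans _ _ (m0 + C / (1 - r))%:E); last by rewrite ltry.
apply: lime_le; first by apply/cvg_ex; eexists; exact: cvgI.
apply: nearW => k; apply: (le_trans (H k)).
rewrite lee_fin lerD2l ler_pM2r ?invr_gt0 ?subr_gt0//.
by rewrite ler_piMr// ?gerBl ?exprn_ge0.
Qed.

End boxes.
(** * Increasing transformations *)

Section transformation_theory.
Context {R : realType}.
Variable h : \bar R -> \bar R.
Hypothesis h_increasing : increasing_transformation h.
Hypothesis h_limit_points : (y_zero h < y_infty h)%E.
Hypothesis h_continuous : continuous_at_limit_points h.
Hypothesis h_C1 : forall y : R, (y_zero h < y%:E < y_infty h)%E ->
  derivable (real_part h) y 1 /\ {for y, continuous (derive1 (real_part h))}.

Lemma transform_mono : {homo h : x y / (x <= y)%E}.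
Proof. by case: h_increasing. Qed.

Lemma transform_ge0 y : (0 <= h y)%E.
Proof. by case: h_increasing. Qed.

Lemma transform_lty y : (y < y_infty h)%E -> (h y < +oo)%E.
Proof.
move=> /ereal_sup_gt[z /= hz yz]; apply: le_lt_trans hz.
exact/transform_mono/ltW.
Qed.

Lemma transform_eq0 y : (y < y_zero h)%E -> h y = 0.
Proof.
move=> yz; apply/eqP; rewrite eq_le transform_ge0 andbT leNgt; apply/negP => hy.
by move: yz; rewrite ltNge => /negP; apply; exact: ereal_inf_lbound.
Qed.

Lemma transform_eqy y : (y_infty h < y)%E -> h y = +oo%E.
Proof.
move=> yy; apply/eqP; rewrite -leye_eq leNgt; apply/negP => hy.
by move: yy; rewrite ltNge => /negP; apply; exact: ereal_sup_ubound.
Qed.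

Lemma transform_fin_num y : (h y < +oo)%E -> h y \is a fin_num.
Proof. by move=> hy; rewrite ge0_fin_numE ?transform_ge0. Qed.

Lemma real_partK (y : R) : (h y%:E < +oo)%E -> (real_part h y)%:E = h y%:E.
Proof. by move=> hy; rewrite /real_part fineK// transform_fin_num. Qed.

(** Below [y_zero h] the transformation is constantly 0, above [y_infty h] constantly infinite, and
    in between it is differentiable; continuity at the two limit points is assumed. *)
Lemma transform_continuous (y : R) : h z%:E @[z --> y] --> h y%:E.
Proof.
have EFin_cvg (a : R) : z%:E @[z --> a] --> a%:E by apply: cvg_EFin; [exact: nearW|exact: cvg_id].
have EFin_y := EFin_cvg y.
have near_lt (l : \bar R) : (y%:E < l)%E -> \forall z \near y, (z%:E < l)%E.
  by move=> yl; apply: (EFin_y [set u | (u < l)%E]); exact: open_ereal_lt'.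
have near_gt (l : \bar R) : (l < y%:E)%E -> \forall z \near y, (l < z%:E)%E.
  by move=> yl; apply: (EFin_y [set u | (l < u)%E]); exact: open_ereal_gt'.
have at_limit (l : \bar R) : {for l, continuous h} -> y%:E = l ->
    h z%:E @[z --> y] --> h y%:E.
  by move=> + yl; rewrite -yl => hc; exact: (@cvg_comp _ _ _ (fun z : R => z%:E) h _ _ _ EFin_y hc).
have [y0|y0|/at_limit] := ltgtP y%:E (y_zero h); last by apply; case: h_continuous.
  rewrite (transform_eq0 y0); apply: cvg_near_cst.
  near=> z; rewrite transform_eq0//.
  near: z; exact: near_lt y0.
have [yi|yi|/at_limit] := ltgtP y%:E (y_infty h); last by apply; case: h_continuous.
  have [/derivable1_diffP/differentiable_continuous rc _] := h_C1 (introT andP (conj y0 yi)).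
  rewrite -(real_partK (transform_lty yi)).
  apply: (@cvg_trans _ ((real_part h z)%:E @[z --> y])).
    apply: near_eq_cvg; near=> z; rewrite real_partK//; apply: transform_lty.
    by near: z; exact: near_lt yi.
  exact: (@cvg_comp _ _ _ (real_part h) (fun z : R => z%:E) _ _ _ rc (EFin_cvg _)).
rewrite (transform_eqy yi); apply: cvg_near_cst.
near=> z; rewrite transform_eqy//.
near: z; exact: near_gt yi.
Unshelve. all: by end_near. Qed.

(** If [h] were bounded on the reals, [y_infty h] would be infinite, and continuity there would
    contradict [h +oo = +oo]. *)
Lemma transform_unbounded (C : R) : exists B : R, (C%:E < h B%:E)%E.
Proof.
apply: contrapT => /forallNP H.
have {}H (B : R) : (h B%:E <= C%:E)%E by rewrite leNgt; exact/negP/H.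
have yy : y_infty h = +oo%E.
  apply/eqyP => A A0; apply: ereal_sup_ubound => /=.
  exact: le_lt_trans (H A) (ltry _).
have [_ +] := h_continuous; rewrite yy => hy.
have [_ _ _ hyy] := h_increasing.
have /hy : nbhs (h +oo%E) [set z | (C%:E < z)%E].
  by apply: open_ereal_gt'; rewrite hyy ltry.
move=> [M [_ /= /(_ (M + 1)%:E)]]; rewrite lte_fin ltrDl ltr01 => /(_ isT).
by rewrite /= ltNge H.
Qed.

Lemma transform_arbitrarily_small (e : R) : 0 < e -> exists A : R, (h A%:E < e%:E)%E.
Proof.
move=> e0; apply: contrapT => /forallNP H.
have {}H (B : R) : (e%:E <= h B%:E)%E by rewrite leNgt; exact/negP/H.
have yy : y_zero h = -oo%E.
  have yle (A : R) : (y_zero h <= A%:E)%E.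
    by apply: ereal_inf_lbound; apply: lt_le_trans (H A); rewrite lte_fin.
  case: (y_zero h) yle => [r /(_ (r - 1))|/(_ 0)|//]; last by rewrite leye_eq.
  by rewrite lee_fin => r1; exfalso; move: r1; lra.
have [+ _] := h_continuous; rewrite yy => hy.
have [_ _ hyy _] := h_increasing.
have /hy : nbhs (h -oo%E) [set z | (z < e%:E)%E].
  by apply: open_ereal_lt'; rewrite hyy lte_fin.
move=> [M [_ /= /(_ (M - 1)%:E)]]; rewrite lte_fin gtrBl ltr01 => /(_ isT).
by rewrite /= ltNge H.
Qed.

(** A finite value at [y_infty h] would, by continuity, extend to points slightly to its right,
    where [h] is infinite. *)
Lemma transform_lty_lt (y : R) : (h y%:E < +oo)%E -> (y%:E < y_infty h)%E.
Proof.
move=> hy; rewrite ltNge; apply/negP => yy.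
have yE : y%:E = y_infty h.
  by apply/eqP; rewrite eq_le yy andbT; exact: ereal_sup_ubound.
have := @transform_continuous y.
have /[swap]/[apply] : nbhs (h y%:E) [set z | (z < +oo)%E].
  exact: open_ereal_lt'.
move=> [e /= e0 /(_ (y + e / 2))].
rewrite /ball/= opprD addNKr normrN gtr0_norm ?divr_gt0//.
rewrite ltr_pdivrMr// ltr_pMr// ltr1n => /(_ isT).
rewrite transform_eqy// -yE lte_fin ltrDl divr_gt0//.
Qed.

Lemma measurable_transform : measurable_fun [set: R] (fun y : R => h y%:E).
Proof.
apply: (measurability _ (ErealGenCInfty.measurableE R)) => _ /= [_ [r ->] <-].
rewrite setTI; apply: is_interval_measurable => s t /=.
rewrite !in_itv/= !andbT => hs ht u /andP[su _].
by rewrite in_itv/= andbT (le_trans hs)// transform_mono// lee_fin.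
Qed.

(** Turns the decay at minus infinity into one bound on the whole half-line below [B]; the shift
    [1 + (B - y)] keeps the base away from 0. *)
Lemma transform_decay (alpha B : R) : 0 < alpha -> (h B%:E < +oo)%E ->
  real_part h y / `|y| `^ (- alpha) @[y --> -oo_R] --> (0 : R) ->
  exists2 C : R, 0 <= C &
    forall y, y <= B -> (h y%:E <= (C / (1 + (B - y)) `^ alpha)%:E)%E.
Proof.
move=> a0 hB /cvgrPdist_le/(_ 1 ltr01)[A [_ hA]].
(* Below [A'] one has [1 + (B - y) <= 2 * |y|], whence the first term of [C]. Between [A'] and [B],
   monotonicity gives the second. *)
pose A' := Num.min A (- (1 + `|B|)).
pose C := Num.max (2 `^ alpha) (real_part h B * (1 + (B - A')) `^ alpha).
exists C; first by rewrite le_max powR_ge0.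
move=> y yB; have hy : (h y%:E < +oo)%E.
  by apply: le_lt_trans hB; rewrite transform_mono// lee_fin.
have by0 : 0 < 1 + (B - y) by lra.
rewrite -real_partK// lee_fin ler_pdivlMr ?powR_gt0//.
have [yA'|yA'] := ltP y A'.
  have yA : y < A by move: yA'; rewrite lt_min => /andP[].
  have y1 : y < - (1 + `|B|) by move: yA'; rewrite lt_min => /andP[].
  have BB := ler_norm B; have BB' := normr_ge0 B.
  have y0 : y < 0 by lra.
  have ny : 0 < `|y| by rewrite normr_gt0 lt_eqF.
  have := hA y yA; rewrite sub0r normrN => /(le_trans (ler_norm _)).
  rewrite ler_pdivrMr ?powR_gt0// mul1r => hy'.
  rewrite le_max; apply/orP; left.
  apply: (@le_trans _ _ (`|y| `^ (- alpha) * (2 * `|y|) `^ alpha)).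
    apply: ler_pM => //; [exact/fine_ge0/transform_ge0|exact: powR_ge0|].
    rewrite ltr0_norm//.
    by apply: ge0_ler_powR; rewrite ?nnegrE; lra.
  rewrite powRM// mulrCA -powRD; last by apply/implyP => _; rewrite gt_eqF.
  by rewrite addNr powRr0 mulr1.
rewrite le_max; apply/orP; right; apply: ler_pM.
- exact/fine_ge0/transform_ge0.
- exact: powR_ge0.
- rewrite /real_part fine_le ?transform_fin_num//.
  by rewrite transform_mono// lee_fin.
- by apply: ge0_ler_powR; rewrite ?nnegrE; lra.
Qed.

End transformation_theory.

(** * Raising a function to mass one *)

Section raising.
Context {R : realType} {d : nat}.
Hypothesis d_gt0 : (0 < d)%N.
Variable h : \bar R -> \bar R.
Hypothesis h_increasing : increasing_transformation h.
Hypothesis h_limit_points : (y_zero h < y_infty h)%E.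
Hypothesis h_continuous : continuous_at_limit_points h.
Hypothesis h_ninfty : exists2 alpha : R, d%:R < alpha &
  real_part h y / `|y| `^ (- alpha) @[y --> -oo_R] --> (0 : R).
Hypothesis h_yinfty : forall yi : R, y_infty h = yi%:E ->
  exists2 beta : R, d%:R < beta &
  asymp (yi^'-) (real_part h) (fun y => (yi - y) `^ (- beta)).
Hypothesis h_C1 : forall y : R, (y_zero h < y%:E < y_infty h)%E ->
  derivable (real_part h) y 1 /\ {for y, continuous (derive1 (real_part h))}.
Local Notation mu := (@lebesgue_rV R d).
Implicit Types w : 'rV[R]_d -> R.

Definition mass w : \bar R := (\int[mu]_(x in orthant R d) h (w x)%:E)%E.

(** What the raising argument uses of a maximum of affine functions with positive slopes: linear
    decay in every coordinate makes the mass finite, and the lower bound on cubes at the origin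
    makes it large after raising. *)
Definition linearly_decreasing w :=
  [/\ measurable_fun [set: 'rV[R]_d] w,
      exists2 e : R, 0 < e &
        forall x j, orthant R d x -> w x <= w 0 - e * x ord0 j
    & exists2 L : R, 0 < L &
        forall t x, box 0 (const_mx t) x -> w 0 - L * t <= w x].

Lemma measurable_transform_comp w (D : set 'rV[R]_d) : measurable D ->
  measurable_fun [set: 'rV[R]_d] w ->
  measurable_fun D (fun x => h (w x)%:E).
Proof.
move=> mD mw; apply: (@measurable_funS _ _ _ _ setT) => //.
exact: (measurableT_comp (measurable_transform h_increasing) mw).
Qed.

Lemma le_mass w w' : measurable_fun [set: 'rV[R]_d] w ->
  measurable_fun [set: 'rV[R]_d] w' ->
  (forall x, orthant R d x -> w x <= w' x) -> (mass w <= mass w')%E.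
Proof.
move=> mw mw' ww'; apply: ge0_le_integral.
- exact: measurable_orthant.
- by move=> x _; exact: transform_ge0.
- by apply: measurable_transform_comp => //; exact: measurable_orthant.
- by apply: measurable_transform_comp => //; exact: measurable_orthant.
- by move=> x Ox; apply: transform_mono => //; rewrite lee_fin ww'.
Qed.

Lemma box_mass_le w (y c : R) a b : measurable_fun [set: 'rV[R]_d] w ->
  box a b `<=` orthant R d -> (forall i, a ord0 i <= b ord0 i) -> 0 <= c ->
  (c%:E <= h y%:E)%E -> (forall x, box a b x -> y <= w x) ->
  ((c * \prod_(i < d) (b ord0 i - a ord0 i))%:E <= mass w)%E.
Proof.
move=> mw sub ab c0 cy yw; apply: box_integral_le => //.
- by apply: measurable_transform_comp => //; exact: measurable_orthant.
- by move=> x _; exact: transform_ge0.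
- move=> x Bx; apply: (le_trans cy); apply: transform_mono => //.
  by rewrite lee_fin yw.
Qed.

Lemma cube_mass_le w (y c t : R) : measurable_fun [set: 'rV[R]_d] w ->
  0 <= t -> 0 <= c ->
  (c%:E <= h y%:E)%E -> (forall x, box 0 (const_mx t) x -> y <= w x) ->
  ((c * t ^+ d)%:E <= mass w)%E.
Proof.
move=> mw t0 c0 cy yw.
have := @box_mass_le w y c 0 (const_mx t) mw.
under eq_bigr do rewrite !mxE subr0.
rewrite big_const_ord iter_mulr_1; apply => //.
- by move=> x Bx j; have /andP[+ _] := Bx j; rewrite mxE.
- by move=> i; rewrite !mxE.
Qed.

(** The shells form a geometric series of ratio [2 ^+ d / q], where [q] is 2 to the power [alpha];
    it is below 1 since [alpha] exceeds [d]. *)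
Lemma mass_lty w : linearly_decreasing w -> (h (w 0)%:E < +oo)%E ->
  (mass w < +oo)%E.
Proof.
move=> [mw [e e0 we] _] hw0; have [alpha da ha] := h_ninfty.
have a0 : 0 < alpha by apply: le_lt_trans da; rewrite ler0n.
have [C C0 hC] := transform_decay h_increasing a0 hw0 ha.
have ww0 x : orthant R d x -> w x <= w 0.
  move=> Ox; have := we x (Ordinal d_gt0) Ox; have := Ox (Ordinal d_gt0); nra.
pose q : R := 2 `^ alpha.
have q0 : 0 < q by exact: powR_gt0.
have q1 : (2 : R) ^+ d < q.
  rewrite /q -(subrKC d%:R alpha) powRD; last by apply/implyP; rewrite pnatr_eq0.
  rewrite powR_mulrn// ltr_pMr ?exprn_gt0//.
  have := @gt0_ltr_powR R (alpha - d%:R); rewrite subr_gt0 => /(_ da 1 2).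
  by rewrite powR1; apply; rewrite ?nnegrE// ltr1n.
(* Where some coordinate exceeds [2 ^+ k], [w] is at most [w 0 - e * 2 ^+ k], and [transform_decay]
   with [B := w 0] applies. *)
apply: (@dyadic_integral_lty R d _ (fine (h (w 0)%:E))
    (C / e `^ alpha * 2 ^+ d) (2 ^+ d / q) (fun k => C / (e * 2 ^+ k) `^ alpha)).
- by apply: measurable_transform_comp => //; exact: measurable_orthant.
- by move=> x _; exact: transform_ge0.
- move=> x Ox; rewrite fineK ?transform_fin_num//.
  by apply: transform_mono => //; rewrite lee_fin ww0.
- move=> k x Ox [j xj]; apply: (le_trans (hC _ (ww0 x Ox))).
  rewrite lee_fin ler_wpM2l// lef_pV2 ?posrE; last 2 first.
  + by rewrite powR_gt0//; have := ww0 x Ox; lra.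
  + by rewrite powR_gt0// mulr_gt0// exprn_gt0.
  have ek : e * 2 ^+ k <= 1 + (w 0 - w x).
    have := we x j Ox; have : e * 2 ^+ k <= e * x ord0 j by rewrite ler_pM2l// ltW.
    lra.
  have e2k : 0 < e * 2 ^+ k by rewrite mulr_gt0// exprn_gt0.
  by apply: ge0_ler_powR; rewrite ?nnegrE; lra.
- by rewrite divr_ge0 ?exprn_ge0 ?ltW//= ltr_pdivrMr// mul1r.
- by move=> k; rewrite divr_ge0// powR_ge0.
- move=> k; rewrite (powRM _ (ltW e0)) ?exprn_ge0//.
  have -> : (2 ^+ k) `^ alpha = q ^+ k.
    by rewrite -powR_mulrn// powRAC powR_mulrn ?powR_ge0.
  rewrite expr_div_n exprS exprMn -!exprM (mulnC k d).
  have e1 : e `^ alpha != 0 by rewrite gt_eqF// powR_gt0.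
  have q2 : q ^+ k != 0 by rewrite expf_neq0// gt_eqF.
  by rewrite le_eqVlt; apply/orP; left; apply/eqP; field; rewrite e1 q2.
Qed.

(** On the cube of side [t], [h] is at least of order [t] to the power [- beta], while the volume is
    [t ^+ d]. Since [beta] exceeds [d], the product blows up as [t] tends to 0; the side [t] does
    not depend on [w]. *)
Lemma mass_gt1_near_yinfty (yi L e : R) : y_infty h = yi%:E -> 0 < L -> 0 < e ->
  exists t, [/\ 0 < t, t < e & forall w, measurable_fun [set: 'rV[R]_d] w ->
    (forall x, box 0 (const_mx t) x -> yi - L * t <= w x) -> (1 < mass w)%E].
Proof.
move=> hyi L0 e0; have [beta db [c [C [c0]]]] := h_yinfty hyi.
move=> [del /= del0 hdel].
have bd : 0 < beta - d%:R by rewrite subr_gt0.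
(* The division by 2 makes the cube contribute at least 2, hence strictly more than 1. *)
pose K := c * L `^ (- beta) / 2.
have K0 : 0 < K by rewrite divr_gt0// mulr_gt0// powR_gt0.
pose t1 := K `^ (beta - d%:R)^-1.
have t10 : 0 < t1 by exact: powR_gt0.
(* The three bounds give [t < e], place [yi - L * t] where the comparison with the power holds, and
   make [t] to the power [beta - d] at most [K]. *)
pose t := Num.min (Num.min (e / 2) (del / (2 * L))) t1.
have t0 : 0 < t by rewrite !lt_min t10 !divr_gt0// mulr_gt0.
have te : t < e by rewrite !gt_min ltr_pdivrMr// ltr_pMr// ltr1n.
have tL : L * t < del.
  have : t <= del / (2 * L) by rewrite !ge_min lexx orbT.
  by rewrite ler_pdivlMr ?mulr_gt0//; nra.
have tK : t `^ (beta - d%:R) <= K.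
  have -> : K = t1 `^ (beta - d%:R).
    by rewrite -powRrM mulVf ?gt_eqF// powRr1// ltW.
  apply: ge0_ler_powR; rewrite ?nnegrE; try by rewrite ltW.
  by rewrite ge_min lexx orbT.
exists t; split => // w mw wt.
have Lt0 : 0 < L * t by exact: mulr_gt0.
have : c <= real_part h (yi - L * t) / (L * t) `^ (- beta).
  have := hdel (yi - L * t); rewrite /ball/= subKr gtr0_norm//.
  by rewrite gtrBl => /(_ tL Lt0)/andP[].
rewrite ler_pdivlMr ?powR_gt0// => hc.
have hy : ((c * (L * t) `^ (- beta))%:E <= h (yi - L * t)%:E)%E.
  rewrite -(real_partK h_increasing) ?lee_fin//.
  by apply: transform_lty => //; rewrite hyi lte_fin gtrBl.
apply: lt_le_trans (cube_mass_le mw (ltW t0) _ hy wt); last first.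
  by rewrite mulr_ge0 ?powR_ge0// ltW.
rewrite lte_fin powRM ?ltW// mulrA -mulrA.
have -> : t `^ (- beta) * t ^+ d = (t `^ (beta - d%:R))^-1.
  rewrite -powR_mulrn ?ltW// -powRD; last by apply/implyP => _; rewrite gt_eqF.
  by rewrite -powRN opprB addrC.
have -> : c * L `^ (- beta) = K * 2 by rewrite /K divfK.
by rewrite ltr_pdivlMr ?powR_gt0// mul1r; lra.
Qed.

(** If [w 0] reached a finite [y_infty h], a small cube at the origin would already carry mass above
    1. *)
Lemma transform0_lty w : linearly_decreasing w -> (mass w <= 1)%E ->
  (h (w 0)%:E < +oo)%E.
Proof.
move=> [mw _ [L L0 wL]] mw1; apply: transform_lty => //.
rewrite ltNge; apply/negP => ywi.
have [yi hyi] : exists yi : R, y_infty h = yi%:E.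
  move: ywi h_limit_points; case: (y_infty h) => [r _ _|+ _|_].
  - by exists r.
  - by rewrite leye_eq.
  - by rewrite ltNge leNye.
have [t [t0 _ /(_ w mw)]] := mass_gt1_near_yinfty hyi L0 ltr01.
rewrite ltNge mw1 => H; suff : false by []; apply: H => x /wL.
by move: ywi; rewrite hyi lee_fin; lra.
Qed.

Lemma linearly_decreasingD w (c : R) : linearly_decreasing w ->
  linearly_decreasing (fun x => w x + c).
Proof.
move=> [mw [e e0 we] [L L0 wL]]; split.
- exact: measurable_funD.
- by exists e => // x j /(we x j); lra.
- by exists L => // t x /wL; lra.
Qed.

Lemma raised_mass_ge1 w : linearly_decreasing w -> (mass w <= 1)%E ->
  exists c : R, [/\ 0 <= c, (h (w 0 + c)%:E < +oo)%E &
                   (1 <= mass (fun x => (w x + c)%R))%E].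
Proof.
move=> lw mw1; have hw0 := transform0_lty lw mw1.
have [mw _ [L L0 wL]] := lw.
have mwc c : measurable_fun [set: 'rV[R]_d] (fun x => w x + c).
  exact: measurable_funD.
have := transform_lty_lt h_increasing h_continuous h_C1 hw0.
case Eyi : (y_infty h) => [yi| |//].
- rewrite lte_fin => w0yi.
  have L1 : 0 < L + 1 by rewrite addr_gt0.
  have e0 : 0 < yi - w 0 by rewrite subr_gt0.
  have [t [t0 te H]] := mass_gt1_near_yinfty Eyi L1 e0.
  (* The value at 0 becomes [yi - t], still below [yi]. On the cube of side [t] the function stays
     above [yi - (L + 1) * t], which is why the slope [L + 1] was used. *)
  exists (yi - w 0 - t); split; first by lra.
    apply: transform_lty => //; rewrite Eyi lte_fin; lra.
  by apply/ltW/H => // x /wL; lra.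
- move=> _; have [B hB] := transform_unbounded h_increasing h_continuous 1.
  (* This lifts [w] above [B] on the unit cube, where [h] then exceeds 1. *)
  exists (Num.max 0 (B - w 0 + L)); split; first by rewrite le_max lexx.
    by apply: transform_lty => //; rewrite Eyi ltry.
  have := @cube_mass_le (fun x => w x + Num.max 0 (B - w 0 + L)) B 1 1 (mwc _).
  rewrite mul1r expr1n; apply => //; first exact: ltW.
  move=> x /wL; rewrite mulr1.
  have : B - w 0 + L <= Num.max 0 (B - w 0 + L) by rewrite le_max lexx orbT.
  lra.
Qed.

Lemma linearly_decreasing_le0 w x : linearly_decreasing w ->
  orthant R d x -> w x <= w 0.
Proof.
move=> [_ [e e0 we] _] Ox; apply: (le_trans (we x (Ordinal d_gt0) Ox)).
by rewrite gerBl mulr_ge0// ltW.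
Qed.

(** Intermediate value theorem in the constant [c] between 0 and [c1]. The mass is continuous in [c]
    by dominated convergence, with the function raised by [c1] as dominating function. *)
Lemma raise_to_mass1 w : linearly_decreasing w -> (mass w <= 1)%E ->
  exists c : R, [/\ 0 <= c, (h (w 0 + c)%:E < +oo)%E &
                   mass (fun x => (w x + c)%R) = 1%E].
Proof.
move=> lw mw1; have [c1 [c10 hc1 mc1]] := raised_mass_ge1 lw mw1.
have [mw _ _] := lw; have mO := @measurable_orthant R d.
(* The minimum makes [W c1] dominate [W c] on an open interval around [[0, c1]]. *)
pose W c x := w x + Num.min c c1.
have lW c : linearly_decreasing (W c) by exact: linearly_decreasingD.
have mW c : measurable_fun [set: 'rV[R]_d] (W c) by case: (lW c).
have Wle c x : orthant R d x -> W c x <= W c1 x.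
  by move=> _; rewrite lerD2l minxx ge_min lexx orbT.
have hW c x : orthant R d x -> (h (W c x)%:E < +oo)%E.
  move=> Ox; apply: le_lt_trans hc1; apply: transform_mono => //.
  rewrite lee_fin (le_trans (Wle c x Ox))// /W minxx lerD2r.
  exact: linearly_decreasing_le0.
pose f c x := fine (h (W c x)%:E).
have fE c x : orthant R d x -> (f c x)%:E = h (W c x)%:E.
  by move=> Ox; rewrite /f fineK// transform_fin_num// hW.
have f0 c x : 0 <= f c x by exact/fine_ge0/transform_ge0.
have O0 : orthant R d 0 by move=> j; rewrite mxE.
have intf c : mu.-integrable (orthant R d) (EFin \o f c).
  apply: (@eq_integrable _ _ _ mu _ mO (fun x => h (W c x)%:E)).
    by move=> x /set_mem Ox /=; rewrite fE.
  apply/integrableP; split; first exact: measurable_transform_comp.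
  under eq_integral do rewrite gee0_abs ?transform_ge0//.
  exact: mass_lty (lW c) (hW c 0 O0).
have cf : {in `]-1, c1 + 1[%classic, continuous
    (fun c => \int[mu]_(x in orthant R d) f c x)}.
  apply: (@continuity_under_integral _ _ _ mu f _ mO _ _ _ _ (f c1)) => //.
  - apply: aeW => x Ox c _.
    have Wc : W c' x @[c' --> c] --> W c x.
      apply: cvgD; first exact: cvg_cst.
      by apply: continuous_min; [exact: cvg_id|exact: cvg_cst].
    have hWc : h (W c' x)%:E @[c' --> c] --> (f c x)%:E.
      rewrite fE//.
      have hc := transform_continuous h_increasing h_continuous h_C1 (y := W c x).
      have := @cvg_comp _ _ _ (W^~ x) (fun z : R => h z%:E) _ _ _ Wc hc.
      exact.
    exact: fine_cvg hWc.
  - move=> c _; apply: aeW => x Ox.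
    rewrite ger0_norm// -lee_fin !fE//.
    by apply: transform_mono => //; rewrite lee_fin Wle.
have IE c : (\int[mu]_(x in orthant R d) f c x)%:E = mass (W c).
  rewrite /Rintegral fineK; last exact: integrable_fin_num (intf c).
  by apply: eq_integral => x /set_mem Ox; rewrite fE.
have [||c] := @IVT R (fun c => \int[mu]_(x in orthant R d) f c x) 0 c1 1 c10.
- apply: continuous_in_subspaceT => c; rewrite inE/= in_itv/= => /andP[c_0 c_1].
  by apply: cf; rewrite inE/= in_itv/=; apply/andP; split; lra.
- rewrite ge_min le_max -!lee_fin !IE.
  rewrite (_ : W c1 = (fun x => w x + c1)); last by apply/funext => x; rewrite /W minxx.
  rewrite (_ : W 0 = w) ?mw1 ?mc1 ?orbT//.
  by apply/funext => x; rewrite /W min_l// addr0.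
rewrite in_itv/= => /andP[c_0 c_1] mc; exists c; split => //.
  by have := hW c 0 O0; rewrite /W min_l.
rewrite -[RHS](congr1 EFin mc) IE.
by congr mass; apply/funext => x; rewrite /W min_l.
Qed.

End raising.

(** * Maxima of affine functions *)

Section affine_bounds.
Context {R : realType} {d : nat}.
Variable h : \bar R -> \bar R.
Hypothesis h_increasing : increasing_transformation h.
Hypothesis h_continuous : continuous_at_limit_points h.
Implicit Types (x a z : 'rV[R]_d) (y : R).

(** The function is anchored at [x], with value [y] there; [a] is minus the gradient, so decreasing
    functions have positive [a]. *)
Definition affine x y a z : R := y - \sum_j a ord0 j * (z ord0 j - x ord0 j).

Lemma measurable_affine x y a : measurable_fun [set: 'rV[R]_d] (affine x y a).
Proof.
apply: measurable_funB => //; apply: measurable_sum => j.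
by apply: measurable_funM => //; apply: measurable_funB => //; exact: measurable_coord.
Qed.

Variable x : 'rV[R]_d.
Hypothesis x_gt0 : forall j, 0 < x ord0 j.

(* If [a ord0 j <= 0], the set where [affine x y a] is at least [y] contains
   boxes of a fixed section that are arbitrarily long in the direction [j]. *)
Lemma affine_slope_gt0 (delta : R) y a : 0 < delta -> (delta%:E <= h y%:E)%E ->
  (mass h (affine x y a) <= 1)%E -> forall j, 0 < a ord0 j.
Proof.
move=> d0 hy m1 j; rewrite ltNge; apply/negP => aj.
pose V := \prod_(i < d | i != j) (x ord0 i / 2).
have V0 : 0 < V by apply: prodr_gt0 => i _; rewrite divr_gt0.
(* With this length the box contributes [delta * (t * V) = 2] to the mass. *)
pose t := 2 / (delta * V); have t0 : 0 < t by rewrite divr_gt0// mulr_gt0.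
(* Each side starts at [x] and goes in a direction where the function does not decrease: length [t]
   upwards along [j], and half of [x ord0 i] along the others, which stays inside the orthant. *)
pose lo : 'rV[R]_d := \row_i (x ord0 i -
  (if i == j then 0 else if 0 <= a ord0 i then x ord0 i / 2 else 0)).
pose hi : 'rV[R]_d := \row_i (x ord0 i +
  (if i == j then t else if 0 <= a ord0 i then 0 else x ord0 i / 2)).
have H : ((delta * \prod_(i < d) (hi ord0 i - lo ord0 i))%:E <=
    mass h (affine x y a))%E.
  apply: (@box_mass_le _ _ _ h_increasing _ y) => //.
  - exact: measurable_affine.
  - move=> z Bz i; have /andP[+ _] := Bz i; rewrite mxE; have := x_gt0 i.
    by case: ifP => _; [|case: ifP => _]; lra.
  - move=> i; rewrite !mxE; have := x_gt0 i.
    by case: ifP => _; [|case: ifP => _]; lra.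
  - exact: ltW.
  - move=> z Bz; rewrite /affine lerBrDr gerDl; apply: sumr_le0 => i _.
    have := Bz i; rewrite !mxE; case: eqP => [->|_ /andP[]].
      by rewrite subr0 => /andP[zj _]; apply: mulr_le0_ge0 => //; lra.
    case: (leP 0 (a ord0 i)) => [ai z1 z2|ai z1 z2].
      by apply: mulr_ge0_le0 => //; lra.
    by apply: mulr_le0_ge0; lra.
have E : \prod_(i < d) (hi ord0 i - lo ord0 i) = t * V.
  rewrite (bigD1 j)//= !mxE eqxx; congr (_ * _); first by lra.
  by apply: eq_bigr => i /negPf ij; rewrite !mxE ij; case: ifP => _; lra.
have := le_trans H m1; rewrite E lee_fin /t.
have -> : delta * (2 / (delta * V) * V) = 2 by field; rewrite !gt_eqF.
by lra.
Qed.

(** On the box between 0 and [s *: x] the minimum of the affine function is at the corner [s *: x],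
    because the slopes are nonnegative. *)
Lemma affine_mass_box (s c : R) y a : (forall j, 0 <= a ord0 j) ->
  0 <= s <= 1 -> 0 <= c ->
  (c%:E <= h (y + (1 - s) * \sum_j a ord0 j * x ord0 j)%:E)%E ->
  (mass h (affine x y a) <= 1)%E -> c * \prod_j (s * x ord0 j) <= 1.
Proof.
move=> a0 /andP[s0 s1] c0 hc m1; rewrite -lee_fin; apply: le_trans m1.
have <- : \prod_j ((s *: x) ord0 j - (0 : 'rV[R]_d) ord0 j) = \prod_j (s * x ord0 j).
  by apply: eq_bigr => j _; rewrite !mxE subr0.
apply: (box_mass_le h_increasing _ _ _ c0 hc).
- exact: measurable_affine.
- by move=> z Bz j; have /andP[+ _] := Bz j; rewrite mxE.
- by move=> j; rewrite !mxE mulr_ge0// ltW.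
- move=> z Bz; rewrite /affine lerD2l mulr_sumr -sumrN; apply: ler_sum => j _.
  have /andP[_] := Bz j; rewrite mxE => zj.
  by rewrite -mulrN mulrCA ler_wpM2l//; lra.
Qed.

(** On the box between 0 and [x] the function is at least [y], so mass at most 1 limits [h y] by the
    inverse volume. *)
Lemma affine_value_le y a : (mass h (affine x y a) <= 1)%E ->
  (h y%:E <= ((\prod_j x ord0 j)^-1)%:E)%E.
Proof.
move=> m1; rewrite leNgt; apply/negP => hy.
set V := \prod_j x ord0 j in hy *; have V0 : 0 < V by exact: prodr_gt0.
(* A real [delta] stands in for [h y%:E], which may be infinite here. *)
have [delta hd] : exists2 delta : R, V^-1 < delta & (delta%:E <= h y%:E)%E.
  move: hy; case: (h y%:E) => [r|_|//]; last by exists (V^-1 + 1); rewrite ?leey// ltrDl.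
  by exists r.
have d0 : 0 < delta by rewrite (lt_trans _ hd)// invr_gt0.
move=> hy'; have a0 := affine_slope_gt0 d0 hy' m1.
have := @affine_mass_box 1 delta y a (fun j => ltW (a0 j)).
rewrite subrr mul0r addr0 lexx ler01 => /(_ isT (ltW d0) hy' m1).
under eq_bigr do rewrite mul1r.
rewrite -/V -ler_pdivlMr// div1r => H; by move: hd; rewrite ltNge H.
Qed.

(** The lower bound on [h] gives [A < y]. The half-size box gives [y + s / 2 < B], where [s] sums
    the positive terms [a ord0 j * x ord0 j]. Together they bound [y], [s] and each slope. *)
Lemma affine_bounds (delta : R) : 0 < delta -> exists M : R, forall y a,
  (mass h (affine x y a) <= 1)%E -> (delta%:E <= h y%:E)%E ->
  `|y| <= M /\ forall j, `|a ord0 j| <= M.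
Proof.
move=> d0.
have [A hA] := transform_arbitrarily_small h_increasing h_continuous d0.
pose V := \prod_j (2^-1 * x ord0 j).
have V0 : 0 < V by apply: prodr_gt0 => j _; rewrite mulr_gt0.
have [B hB] := transform_unbounded h_increasing h_continuous (2 / V).
pose N := `|A| + `|B|.
have N0 : 0 <= N by rewrite addr_ge0.
exists (N + \sum_j 2 * N / x ord0 j) => y a m1 hy.
have a0 := affine_slope_gt0 d0 hy m1.
set s := \sum_j a ord0 j * x ord0 j.
have s0 : 0 <= s by apply: sumr_ge0 => j _; rewrite mulr_ge0 ?ltW.
have Ay : A < y.
  rewrite ltNge; apply/negP => yA; move: hA; rewrite ltNge => /negP; apply.
  by apply: (le_trans hy); apply: transform_mono; rewrite ?lee_fin.
have yB : y + 2^-1 * s < B.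
  rewrite ltNge; apply/negP => By.
  have hB' : ((2 / V)%:E <= h (y + (1 - 2^-1) * s)%:E)%E.
    by apply: (le_trans (ltW hB)); apply: transform_mono; rewrite ?lee_fin//; lra.
  have half01 : 0 <= (2^-1 : R) <= 1 by rewrite invr_ge0 ler0n invf_le1 ?ler1n.
  have V2 : 0 <= 2 / V by rewrite divr_ge0 ?ltW.
  have := affine_mass_box (fun j => ltW (a0 j)) half01 V2 hB' m1.
  by rewrite -/V divfK ?gt_eqF//; lra.
have AN := ler_norm (- A); rewrite normrN in AN.
have BN := ler_norm B; have A0 := normr_ge0 A; have B0 := normr_ge0 B.
have S0 : 0 <= \sum_j 2 * N / x ord0 j.
  by apply: sumr_ge0 => j _; rewrite !mulr_ge0// invr_ge0 ltW.
split.
  by rewrite ler_norml /N; move: S0 s0 yB Ay; lra.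
move=> j; rewrite gtr0_norm//.
apply: (@le_trans _ _ (2 * N / x ord0 j)).
  rewrite ler_pdivlMr//; apply: (@le_trans _ _ s).
    by rewrite /s (bigD1 j)//= lerDl sumr_ge0// => i _; rewrite mulr_ge0// ltW.
  by rewrite /N; lra.
rewrite (bigD1 j)//= addrCA lerDl addr_ge0// sumr_ge0// => i _.
by rewrite !mulr_ge0// invr_ge0 ltW.
Qed.

End affine_bounds.

Lemma cvg_maxr (R : realType) {T : Type} (F : set_system T) {FF : Filter F}
    (f g : T -> R) (a b : R) :
  f k @[k --> F] --> a -> g k @[k --> F] --> b ->
  Num.max (f k) (g k) @[k --> F] --> Num.max a b.
Proof.
move=> fa gb; under eq_fun do rewrite maxr_absE; rewrite maxr_absE.
apply: cvgM; last exact: cvg_cst.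
by apply: cvgD; [exact: cvgD|apply: cvg_norm; exact: cvgB].
Qed.

(** * Compactness of the feasible parameters and existence of a maximizer *)

Section feasible.
Context {R : realType} {d n : nat}.
Hypothesis d_gt0 : (0 < d)%N.
Variables (i0 : 'I_n) (h : \bar R -> \bar R).
Hypothesis h_increasing : increasing_transformation h.
Hypothesis h_continuous : continuous_at_limit_points h.
Hypothesis h_C1 : forall y : R, (y_zero h < y%:E < y_infty h)%E ->
  derivable (real_part h) y 1 /\ {for y, continuous (derive1 (real_part h))}.
Variable x : 'I_n -> 'rV[R]_d.
Hypothesis x_gt0 : forall i j, 0 < x i ord0 j.
Implicit Types (t : 'rV[R]_(n * d.+1)) (z : 'rV[R]_d).

(* A row vector [t] encodes [n] affine functions: the value of the [i]-th one at
   [x i], followed by the opposite of its gradient. *)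
Definition value t i : R := t ord0 (mxvec_index i ord0).
Definition slope t i : 'rV[R]_d := \row_j t ord0 (mxvec_index i (lift ord0 j)).
Definition piece t i : 'rV[R]_d -> R := affine (x i) (value t i) (slope t i).
(** The default value is itself one of the pieces, so it does not alter the maximum; [i0] witnesses
    that there is one. *)
Definition upper t z : R := \big[Num.max/piece t i0 z]_i piece t i z.

Lemma piece_le_upper t i z : piece t i z <= upper t z.
Proof. exact: le_bigmax. Qed.

Lemma upper_le t z c : (forall i, piece t i z <= c) -> upper t z <= c.
Proof. by move=> H; exact: bigmax_le. Qed.

Lemma value_le_upper t i : value t i <= upper t (x i).
Proof.
apply: le_trans (piece_le_upper t i (x i)); rewrite /piece /affine big1 ?subr0//.
by move=> j _; rewrite subrr mulr0.
Qed.

Lemma measurable_piece t i : measurable_fun [set: 'rV[R]_d] (piece t i).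
Proof. exact: measurable_affine. Qed.

Lemma measurable_upper t : measurable_fun [set: 'rV[R]_d] (upper t).
Proof.
rewrite /upper; elim: (index_enum _) => [|i s IH].
  by under eq_fun do rewrite big_nil; exact: measurable_piece.
under eq_fun do rewrite big_cons.
by apply: measurable_maxr => //; exact: measurable_piece.
Qed.

Section convergence.
Context {T : Type} (F : set_system T) {FF : Filter F}.
Variables (u : T -> 'rV[R]_(n * d.+1)) (t : 'rV[R]_(n * d.+1)).
Hypothesis ut : u k @[k --> F] --> t.

Lemma coord_cvg j : u k ord0 j @[k --> F] --> t ord0 j.
Proof.
have := @cvg_comp _ _ _ u (fun M : 'rV[R]_(n * d.+1) => M ord0 j) _ _ _ ut
  (@coord_continuous R 1 (n * d.+1) ord0 j t).
exact.
Qed.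

Lemma value_cvg i : value (u k) i @[k --> F] --> value t i.
Proof. exact: coord_cvg. Qed.

Lemma slope_cvg i j : slope (u k) i ord0 j @[k --> F] --> slope t i ord0 j.
Proof. by rewrite mxE; under eq_fun do rewrite mxE; exact: coord_cvg. Qed.

Lemma upper_cvg z : upper (u k) z @[k --> F] --> upper t z.
Proof.
have pc i : piece (u k) i z @[k --> F] --> piece t i z.
  apply: cvgB; first exact: value_cvg.
  apply: cvg_big => [|j _]; first exact: add_continuous.
  by apply: cvgM; [exact: slope_cvg|exact: cvg_cst].
rewrite /upper; elim: (index_enum _) => [|i s IH].
  by under eq_fun do rewrite big_nil; rewrite big_nil; exact: pc.
under eq_fun do rewrite big_cons; rewrite big_cons.
by apply: cvg_maxr; [exact: pc|exact: IH].
Qed.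

Lemma transform_upper_cvg z :
  h (upper (u k) z)%:E @[k --> F] --> h (upper t z)%:E.
Proof.
have hc := transform_continuous h_increasing h_continuous h_C1 (y := upper t z).
by have := @cvg_comp _ _ _ _ (fun y : R => h y%:E) _ _ _ (@upper_cvg z) hc; exact.
Qed.

Lemma transform_value_cvg i :
  h (value (u k) i)%:E @[k --> F] --> h (value t i)%:E.
Proof.
have hc := transform_continuous h_increasing h_continuous h_C1 (y := value t i).
by have := @cvg_comp _ _ _ _ (fun y : R => h y%:E) _ _ _ (@value_cvg i) hc; exact.
Qed.

End convergence.

(** Fatou's lemma, since the integrands converge pointwise by continuity of [h]. *)
Lemma mass_upper_closed (u : nat -> 'rV[R]_(n * d.+1)) t :
  u k @[k --> \oo] --> t -> (forall k, (mass h (upper (u k)) <= 1)%E) ->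
  (mass h (upper t) <= 1)%E.
Proof.
move=> ut u1.
have mO := @measurable_orthant R d.
have mf k : measurable_fun (orthant R d) (fun z => h (upper (u k) z)%:E).
  by apply: measurable_transform_comp => //; exact: measurable_upper.
have := fatou (@lebesgue_rV R d) mO mf
  (fun k z _ => transform_ge0 h_increasing (upper (u k) z)%:E).
rewrite (_ : (\int[_]_(z in _) _)%E = mass h (upper t)); last first.
  apply: eq_integral => z _.
  by have [-> _] := cvg_limn_einf_sup (transform_upper_cvg ut (z := z)).
move=> /le_trans; apply; rewrite limn_einf_lim; apply: lime_le.
  exact: is_cvg_einfs.
apply: nearW => k; apply: le_trans (u1 k).
by apply: ereal_inf_lbound; exists k => /=.
Qed.

Lemma piece_mass_le1 t i : (mass h (upper t) <= 1)%E -> (mass h (piece t i) <= 1)%E.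
Proof.
apply: le_trans; apply: le_mass => //; [exact: measurable_piece|exact: measurable_upper|].
by move=> z _; exact: piece_le_upper.
Qed.

Lemma value_le t i : (mass h (upper t) <= 1)%E ->
  (h (value t i)%:E <= ((\prod_j x i ord0 j)^-1)%:E)%E.
Proof. by move=> /(piece_mass_le1 i); apply: affine_value_le. Qed.

(** It uses the coordinates [value t i] in place of the possibly larger [upper t (x i)]; the two
    agree for tangents to a convex function. *)
Definition likelihood t : R := \prod_i fine (h (value t i)%:E).

Definition feasible (l : R) : set 'rV[R]_(n * d.+1) :=
  [set t | (mass h (upper t) <= 1)%E /\ l <= likelihood t].

Lemma likelihood_cvg {T : Type} (F : set_system T) {FF : Filter F}
    (u : T -> 'rV[R]_(n * d.+1)) t :
  (mass h (upper t) <= 1)%E -> u k @[k --> F] --> t ->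
  likelihood (u k) @[k --> F] --> likelihood t.
Proof.
move=> t1 ut; apply: cvg_big => [|i _]; first exact: mul_continuous.
(* Passing to real values requires a finite limit, which [value_le] provides. *)
apply: fine_cvg; rewrite fineK; first exact: transform_value_cvg.
by apply: transform_fin_num => //; exact: le_lt_trans (value_le i t1) (ltry _).
Qed.

(** All other factors of the likelihood are bounded above by [value_le], so a likelihood of at least
    [l] keeps each factor away from 0. *)
Lemma feasible_value_ge l : 0 < l -> forall i, exists2 delta : R, 0 < delta &
  forall t, feasible l t -> (delta%:E <= h (value t i)%:E)%E.
Proof.
move=> l0 i; pose V k := \prod_j x k ord0 j.
have V0 k : 0 < V k by apply: prodr_gt0 => j _; exact: x_gt0.
exists (l * \prod_(k | k != i) V k).
  by rewrite mulr_gt0// prodr_gt0// => k _; exact: V0.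
move=> t [t1 lt].
have hk k : h (value t k)%:E \is a fin_num.
  by apply: transform_fin_num => //; exact: le_lt_trans (value_le k t1) (ltry _).
rewrite -(fineK (hk i)) lee_fin.
rewrite -ler_pdivlMr ?prodr_gt0// -prodfV.
apply: (le_trans lt); rewrite /likelihood (bigD1 i)//=.
apply: ler_wpM2l; first exact/fine_ge0/transform_ge0.
apply: ler_prod => k _; rewrite fine_ge0 ?transform_ge0//=.
by rewrite -lee_fin fineK//; exact: value_le.
Qed.

Lemma feasible_slope_gt0 l t : 0 < l -> feasible l t ->
  forall i j, 0 < slope t i ord0 j.
Proof.
move=> l0 ft i; have [delta d0 /(_ t ft) hd] := feasible_value_ge l0 i.
by apply: (affine_slope_gt0 h_increasing (x_gt0 i) d0 hd); apply: piece_mass_le1; case: ft.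
Qed.

Lemma feasible_bounded l : 0 < l -> exists M : R,
  forall t, feasible l t -> forall k, `|t ord0 k| <= M.
Proof.
move=> l0.
have /choice[M HM] : forall i, exists M : R, forall t, feasible l t ->
    `|value t i| <= M /\ forall j, `|slope t i ord0 j| <= M.
  move=> i; have [delta d0 hd] := feasible_value_ge l0 i.
  have [M HM] := affine_bounds h_increasing h_continuous (x_gt0 i) d0.
  exists M => t ft; apply: HM; last exact: hd.
  by apply: piece_mass_le1; case: ft.
exists (\sum_i `|M i|) => t ft k; case/mxvec_indexP: k => i j.
apply: (@le_trans _ _ (M i)); last first.
  by rewrite (le_trans (ler_norm _))// (bigD1 i)//= lerDl sumr_ge0.
have [Hv Hs] := HM i t ft.
by case: (unliftP ord0 j) => [j'|] ->//; have := Hs j'; rewrite mxE.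
Qed.

(** A closed subset of a cube. Closedness is checked along sequences, as Fatou's lemma requires. *)
Lemma feasible_compact l : 0 < l -> compact (feasible l).
Proof.
move=> l0; have [M HM] := feasible_bounded l0.
pose B := [set t : 'rV[R]_(n * d.+1) | forall k, `[- M, M]%classic (t ord0 k)].
apply: (subclosed_compact (B := B)).
- move=> t clt.
  have /choice[u Hu] : forall k : nat, exists u, feasible l u /\ `|t - u| < k.+1%:R^-1.
    move=> k; have [u [fu tu]] := clt _ (nbhsx_ballx t k.+1%:R^-1 (ltac:(by rewrite invr_gt0))).
    by exists u; split => //; move: tu; rewrite mx_norm_ball.
  have ut : u k @[k --> \oo] --> t.
    apply/cvgrPdist_lt => e e0; near=> k; apply: (lt_trans (Hu k).2).
    by near: k; exact: near_infty_natSinv_lt (PosNum e0).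
  have t1 : (mass h (upper t) <= 1)%E by apply: (mass_upper_closed ut) => k; case: (Hu k) => -[].
  split => //.
  have lu : likelihood (u k) @[k --> \oo] --> likelihood t.
    exact: likelihood_cvg ut.
  rewrite -(cvg_lim _ lu)//; apply: limr_ge; first by apply/cvg_ex; eexists; exact: lu.
  by apply: nearW => k; case: (Hu k) => -[].
- exact: (@rV_compact R _ (fun=> `[- M, M]%classic) (fun=> @segment_compact R _ _)).
- by move=> t ft k; rewrite /= in_itv/= -ler_norml HM.
Unshelve. all: by end_near. Qed.

Lemma likelihood_max l : 0 < l -> feasible l !=set0 ->
  exists2 t, feasible l t & forall t', feasible l t' -> likelihood t' <= likelihood t.
Proof.
move=> l0 fn.
have [|t /set_mem ft tmax] := EVT_max_rV fn (feasible_compact l0) (f := likelihood).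
  apply: continuous_in_subspaceT => t /set_mem[t1 _].
  exact: (@likelihood_cvg _ (nbhs t) _ id t t1 (fun _ => id)).
by exists t => // t' ft'; apply: tmax; rewrite inE.
Qed.

Lemma piece_gradient t i z :
  piece t i z = piece t i 0 - \sum_j slope t i ord0 j * z ord0 j.
Proof.
rewrite /piece /affine -addrA -opprD -big_split/=; congr (_ - _).
by apply: eq_bigr => j _; rewrite [(0 : 'rV_d) _ _]mxE; ring.
Qed.

Lemma upper_linearly_decreasing t : (forall i j, 0 < slope t i ord0 j) ->
  linearly_decreasing (upper t).
Proof.
move=> t0; split; first exact: measurable_upper.
- pose e := \big[Num.min/1]_(p : 'I_n * 'I_d) slope t p.1 ord0 p.2.
  exists e; first by apply: lt_bigmin => // -[i j] _; exact: t0.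
  move=> z j Oz; apply: upper_le => i.
  rewrite lerBrDr; apply: le_trans (piece_le_upper t i 0).
  rewrite piece_gradient.
  have ej : e <= slope t i ord0 j by exact: (bigmin_le _ (i, j)).
  suff : e * z ord0 j <= \sum_k slope t i ord0 k * z ord0 k by lra.
  rewrite (bigD1 j)//=; apply: (le_trans (ler_wpM2r (Oz j) ej)).
  by rewrite lerDl sumr_ge0// => k _; rewrite mulr_ge0// ltW.
- pose L := 1 + \sum_i \sum_j slope t i ord0 j.
  have S0 i : 0 <= \sum_j slope t i ord0 j by apply: sumr_ge0 => j _; exact: ltW.
  exists L; first by rewrite ltr_pwDl// sumr_ge0.
  move=> s z Bz; rewrite lerBlDr; apply: upper_le => i.
  have s0 : 0 <= s.
    by have /andP[] := Bz (Ordinal d_gt0); rewrite !mxE; exact: le_trans.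
  suff : \sum_j slope t i ord0 j * z ord0 j <= L * s.
    by have := piece_le_upper t i z; rewrite piece_gradient; lra.
  apply: (@le_trans _ _ (\sum_j slope t i ord0 j * s)).
    apply: ler_sum => j _; have /andP[_] := Bz j; rewrite mxE => zs.
    by rewrite ler_wpM2l// ltW.
  rewrite -mulr_suml ler_wpM2r// /L (bigD1 i)//= addrCA lerDl addr_ge0//.
  exact: sumr_ge0.
Qed.

Lemma upper_convex t (z z' : 'rV[R]_d) (s : R) : 0 <= s <= 1 ->
  upper t (s *: z + (1 - s) *: z') <= s * upper t z + (1 - s) * upper t z'.
Proof.
move=> /andP[s0 s1]; apply: upper_le => i.
have -> : piece t i (s *: z + (1 - s) *: z') =
    s * piece t i z + (1 - s) * piece t i z'.
  rewrite (piece_gradient t i z) (piece_gradient t i z') (piece_gradient t i (_ + _)).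
  have -> : \sum_j slope t i ord0 j * (s *: z + (1 - s) *: z') ord0 j =
      s * \sum_j slope t i ord0 j * z ord0 j +
      (1 - s) * \sum_j slope t i ord0 j * z' ord0 j.
    rewrite !mulr_sumr -big_split/=; apply: eq_bigr => j _.
    have -> : (s *: z + (1 - s) *: z') ord0 j = s * z ord0 j + (1 - s) * z' ord0 j.
      by rewrite !mxE.
    by ring.
  by ring.
by apply: lerD; apply: ler_wpM2l; rewrite ?subr_ge0 ?piece_le_upper.
Qed.

(** A union of open half-spaces; this yields lower semicontinuity of the estimator. *)
Lemma upper_gt_open t (a : R) : open [set z | a < upper t z].
Proof.
have -> : [set z | a < upper t z] = \bigcup_i [set z | a < piece t i z].
  apply/seteqP; split => [z az|z [i _ az]]; last exact: lt_le_trans (piece_le_upper t i z).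
  apply: contrapT => H; move: az; rewrite /= ltNge => /negP; apply.
  by apply: upper_le => i; rewrite leNgt; apply/negP => az; apply: H; exists i.
apply: bigcup_open => i _; rewrite openE => z az.
have pz : piece t i y @[y --> z] --> piece t i z.
  apply: (@cvgB _ _ _ (nbhs z)); first exact: cvg_cst.
  apply: (@cvg_big _ _ _ _ _ _ _ (nbhs z)) => [|j _]; first exact: add_continuous.
  apply: (@cvgM _ _ (nbhs z)); first exact: cvg_cst.
  apply: (@cvgB _ _ _ (nbhs z)); last exact: cvg_cst.
  exact: (@coord_continuous R 1 d ord0 j z).
by apply: (pz [set r | a < r]); exact: open_nbhs_nbhs (conj (@open_gt _ a) az).
Qed.

End feasible.

(** * Existence of the maximum likelihood estimator *)

Section likelihood_comparison.
Context {R : realType}.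
Local Open Scope ereal_scope.

Lemma sum_lne (n : nat) (u : 'I_n -> R) : (forall i, (0 <= u i)%R) ->
  \sum_(i < n) lne (u i)%:E = lne (\prod_(i < n) u i)%:E.
Proof.
move=> u0.
suff [_ ->] : ((0 <= \prod_(i < n) u i)%R /\
  \sum_(i < n) lne (u i)%:E = lne (\prod_(i < n) u i)%:E) by [].
elim/big_rec2 : _ => [|i y2 y1 _ [y10 ->]]; first by rewrite lne_EFin// ln1.
split; first exact: mulr_ge0.
(* A zero factor makes both sides [-oo]; no term is [+oo], so the sum absorbs it. *)
have [ui0|ui0] := eqVneq (u i) 0%R.
  by rewrite ui0 mul0r le0_lneNy// addNye.
have [->|y1n0] := eqVneq y1 0%R.
  rewrite mulr0 [in X in _ + X]le0_lneNy// addeNy ?le0_lneNy//.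
have ui_gt0 : (0 < u i)%R by rewrite lt_neqAle eq_sym ui0 u0.
have y1_gt0 : (0 < y1)%R by rewrite lt_neqAle eq_sym y1n0.
by rewrite EFinM lneM// in_itv/= lte_fin leey andbT.
Qed.

End likelihood_comparison.

(** * Model functions and extension by infinity off the orthant *)

Section model_functions.
Context {R : realType} {d : nat}.
Variable h : \bar R -> \bar R.
Hypothesis h_increasing : increasing_transformation h.
Local Notation mu := (@lebesgue_rV R d).
Implicit Types g : 'rV[R]_d -> \bar R.

Lemma model_function_lty g z : model_functions h g -> orthant R d z ->
  (h (g z) < +oo)%E.
Proof.
move=> [_ [[_ _ [M gM] _] _]] Oz; apply: le_lt_trans (ltry M).
by have := gM z; rewrite /transformed patchE mem_set.
Qed.

Lemma model_minorant_mass g (w : 'rV[R]_d -> R) : model_functions h g ->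
  measurable_fun [set: 'rV[R]_d] w ->
  (forall z, orthant R d z -> ((w z)%:E <= g z)%E) -> (mass h w <= 1)%E.
Proof.
move=> [_ [[mg _ _ <-] _]] mw wg; have mO := @measurable_orthant R d.
rewrite -integral_mkcond; apply: ge0_le_integral => //.
- by move=> z _; exact: transform_ge0.
- exact: measurable_transform_comp.
- by apply/measurable_restrictT.
- by move=> z /wg; exact: transform_mono.
Qed.

Definition orthant_function (w : 'rV[R]_d -> R) : 'rV[R]_d -> \bar R :=
  fun z => if z \in orthant R d then (w z)%:E else +oo%E.

Lemma orthant_functionE w z : orthant R d z -> orthant_function w z = (w z)%:E.
Proof. by move=> Oz; rewrite /orthant_function mem_set. Qed.

Lemma orthant_functionNE w z : ~ orthant R d z -> orthant_function w z = +oo%E.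
Proof. by move=> Oz; rewrite /orthant_function memNset. Qed.

Lemma orthant_function_convex (w : 'rV[R]_d -> R) :
  (forall z z' s, 0 < s < 1 -> w (s *: z + (1 - s) *: z') <= s * w z + (1 - s) * w z') ->
  (forall a, open [set z | a < w z]) ->
  convex_on_orthant (orthant_function w).
Proof.
move=> wc wo.
have dom : effective_domain (orthant_function w) = orthant R d.
  apply/seteqP; split => z; rewrite /effective_domain/=.
    by have [//|/orthant_functionNE ->] := pselect (orthant R d z).
  by move=> /orthant_functionE ->; rewrite ltry.
split => //; split.
- move=> z z' s /[dup] s01 /andP[s0 s1].
  have s1' : 0 < 1 - s by rewrite subr_gt0.
  have wNy y : (-oo < orthant_function w y)%E.
    by rewrite /orthant_function; case: ifP; rewrite ?ltNyr.
  have mulNy (r : R) y : 0 < r -> (-oo < r%:E * orthant_function w y)%E.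
    move=> r0; rewrite /orthant_function; case: ifP => _; first by rewrite -EFinM ltNyr.
    by rewrite gt0_muley ?lte_fin.
  (* If either endpoint is outside the orthant, the right-hand side is [+oo]. *)
  have [Oz|Oz] := pselect (orthant R d z); last first.
    rewrite (orthant_functionNE _ Oz) gt0_muley ?lte_fin// addye ?leey//.
    by rewrite gt_eqF// mulNy.
  have [Oz'|Oz'] := pselect (orthant R d z'); last first.
    rewrite (orthant_functionNE _ Oz') gt0_muley ?lte_fin// addey ?leey//.
    by rewrite gt_eqF// mulNy.
  rewrite !orthant_functionE//; last by apply: orthant_convexW => //; exact: ltW.
  by rewrite -!EFinM -EFinD lee_fin wc.
- split; first by move=> z; rewrite /orthant_function; case: ifP; rewrite ?ltNyr.
  by exists 0; rewrite dom => j; rewrite mxE.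
- move=> z a; have [Oz|Oz _] := pselect (orthant R d z).
    rewrite orthant_functionE// lte_fin => az.
    exists [set y | a < w y]; first exact: open_nbhs_nbhs.
    move=> y ay; rewrite /orthant_function; case: ifP => _; last by rewrite ltry.
    by rewrite lte_fin.
  (* Off the orthant some coordinate is negative, and it remains so nearby; hence the function is
     [+oo] on a neighbourhood. *)
  have [j zj] : exists j, z ord0 j < 0.
    by apply: contrapT => /forallNP H; apply: Oz => j; rewrite leNgt; apply/negP/H.
  exists [set y : 'rV[R]_d | y ord0 j < 0].
    apply: (@coord_continuous R 1 d ord0 j z [set r | r < 0]).
    by apply: open_nbhs_nbhs; split => //; exact: open_lt.
  move=> y yj; rewrite orthant_functionNE ?ltry// => /(_ j).
  by rewrite leNgt => /negP.
Qed.

Lemma model_functions_orthant w (M : R) :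
  convex_on_orthant (orthant_function w) ->
  measurable_fun [set: 'rV[R]_d] w ->
  (forall z, orthant R d z -> (h (w z)%:E <= M%:E)%E) ->
  mass h w = 1%E -> model_functions h (orthant_function w).
Proof.
move=> wc mw wM w1; have mO := @measurable_orthant R d.
have E z : orthant R d z -> h (orthant_function w z) = h (w z)%:E.
  by move=> Oz; rewrite orthant_functionE.
split => //; split; last by exists (orthant_function w).
split.
- apply/(measurable_restrictT _ mO).
  apply: (eq_measurable_fun (fun z => h (w z)%:E)).
    by move=> z /set_mem Oz; rewrite /= E.
  exact: measurable_transform_comp.
- by move=> z; apply: erestrict_ge0 => y _; exact: transform_ge0.
(* The bound must also cover the value 0 taken off the orthant. *)
- exists (Num.max M 0) => z; rewrite /transformed patchE; case: ifPn => [/set_mem Oz|_].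
    by rewrite /= E// (le_trans (wM z Oz))// lee_fin le_max lexx.
  by rewrite lee_fin le_max lexx orbT.
- rewrite -integral_mkcond -w1; apply: eq_integral => z /set_mem Oz.
  by rewrite /= E.
Qed.

End model_functions.

(** * Almost sure properties of an observation *)

Section sampling.
Context {R : realType} {d : nat} {disp : measure_display}
  {T : measurableType disp} (P : probability T R).
Local Notation mu := (@lebesgue_rV R d).

(** The exceptional set lies in the union of a null set and the zero set of [p]; the integral of [p]
    over this union vanishes. *)
Lemma density_ae (X : {RV P >-> 'rV[R]_d}) (p : 'rV[R]_d -> \bar R) (B : set 'rV[R]_d) :
  has_density X p -> measurable_fun [set: 'rV[R]_d] p ->
  {ae mu, forall x, B x} -> {ae P, forall w, B (X w) /\ p (X w) != 0}.
Proof.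
move=> Xp mp [N [mN N0 BN]].
have mZ : measurable [set x | p x = 0].
  rewrite -[X in measurable X]setTI.
  exact: (mp measurableT [set 0] (emeasurable_set1 0)).
pose D := N `|` [set x | p x = 0].
have mD : measurable D by exact: measurableU.
exists (X @^-1` D); split.
- by rewrite -[X in measurable X]setTI; exact: measurable_funPT.
- rewrite (Xp _ mD) (@ae_eq_integral _ _ _ mu D (cst 0%E) p)//.
  + by rewrite integral0.
  + exact: measurable_funS mp.
  + exists N; split => // x /= /not_implyP[[//|px]].
    by rewrite px.
- move=> w /= /not_andP[nB|/negP/negPn/eqP pw]; first by left; exact: BN.
  by right.
Qed.

End sampling.

Section maximum_likelihood.
Context {R : realType} {d n : nat}.
Hypothesis d_gt0 : (0 < d)%N.
Variable h : \bar R -> \bar R.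
Hypothesis h_increasing : increasing_transformation h.
Hypothesis h_limit_points : (y_zero h < y_infty h)%E.
Hypothesis h_continuous : continuous_at_limit_points h.
Hypothesis h_ninfty : exists2 alpha : R, d%:R < alpha &
  real_part h y / `|y| `^ (- alpha) @[y --> -oo_R] --> (0 : R).
Hypothesis h_yinfty : forall yi : R, y_infty h = yi%:E ->
  exists2 beta : R, d%:R < beta &
  asymp (yi^'-) (real_part h) (fun y => (yi - y) `^ (- beta)).
Hypothesis h_C1 : forall y : R, (y_zero h < y%:E < y_infty h)%E ->
  derivable (real_part h) y 1 /\ {for y, continuous (derive1 (real_part h))}.
Variables (i0 : 'I_n) (x : 'I_n -> 'rV[R]_d).
Hypothesis x_gt0 : forall i j, 0 < x i ord0 j.

Let x_orthant i : orthant R d (x i).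
Proof. by move=> j; exact: ltW. Qed.

Definition sample_likelihood (g : 'rV[R]_d -> \bar R) : R :=
  \prod_i fine (h (g (x i))).

Lemma log_likelihoodE g : model_functions h g ->
  log_likelihood h x g = ((n%:R^-1)%:E * lne (sample_likelihood g)%:E)%E.
Proof.
move=> mg; rewrite /log_likelihood -sum_lne; last first.
  by move=> i; exact/fine_ge0/transform_ge0.
congr (_ * _)%E; apply: eq_bigr => i _; rewrite fineK// transform_fin_num//.
exact: model_function_lty mg (x_orthant i).
Qed.

Lemma le_log_likelihood g g' : model_functions h g -> model_functions h g' ->
  sample_likelihood g' <= sample_likelihood g ->
  (log_likelihood h x g' <= log_likelihood h x g)%E.
Proof.
move=> mg mg' gg'; rewrite !log_likelihoodE//.
have s0 f : 0 <= sample_likelihood f.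
  by apply: prodr_ge0 => i _; exact/fine_ge0/transform_ge0.
by rewrite lee_wpmul2l ?lee_fin ?invr_ge0 ?lee_lne ?in_itv/= ?lee_fin ?s0 ?leey.
Qed.

(** The tangents of [g] at the observations lie below [g], so their maximum has mass at most 1, and
    they take the values of [g] there, so the likelihood is unchanged. *)
Lemma feasible_subgradients g l : model_functions h g ->
  l <= sample_likelihood g ->
  exists2 t, feasible i0 h x l t & likelihood h t = sample_likelihood g.
Proof.
move=> mg lg; have [gc _] := mg.
have /choice[a Ha] := fun i => subgradient_exists gc (x_gt0 i).
(* Row [i] holds the value at [x i] in column 0 and the slope in the remaining columns. *)
pose A : 'M[R]_(n, d.+1) := \matrix_(i, j)
  if unlift ord0 j is Some k then a i ord0 k else fine (g (x i)).
have vt i : value (mxvec A) i = fine (g (x i)).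
  by rewrite /value mxvecE mxE unlift_none.
have st i : slope (mxvec A) i = a i.
  by apply/rowP => j; rewrite mxE mxvecE mxE liftK.
have tE : likelihood h (mxvec A) = sample_likelihood g.
  apply: eq_bigr => i _; rewrite vt fineK//.
  exact: orthant_fin_num gc _ (x_orthant i).
exists (mxvec A) => //; split; last by rewrite tE.
apply: (model_minorant_mass h_increasing mg); first exact: measurable_upper.
move=> z Oz; rewrite -(fineK (orthant_fin_num gc Oz)) lee_fin.
apply: upper_le => i; rewrite -lee_fin fineK; last exact: orthant_fin_num gc _ Oz.
by rewrite /piece vt st; exact: Ha.
Qed.

Lemma mle_exists g0 : model_functions h g0 ->
  (forall i, (0 < h (g0 (x i)))%E) -> exists g, is_mle h x g.
Proof.
move=> mg0 g0_gt0.
(* The positive likelihood of [g0] is the level that makes the feasible set compact and nonempty. *)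
have l0 : 0 < sample_likelihood g0.
  apply: prodr_gt0 => i _; apply: fine_gt0; rewrite g0_gt0/=.
  exact: model_function_lty mg0 (x_orthant i).
have [t0 ft0 _] := feasible_subgradients mg0 (lexx _).
have [t ft tmax] := likelihood_max h_increasing h_continuous h_C1 x_gt0 l0
  (ex_intro _ t0 ft0).
have lt := upper_linearly_decreasing d_gt0 i0 x
  (feasible_slope_gt0 h_increasing x_gt0 l0 ft).
have [c [c0 hc mc]] := raise_to_mass1 d_gt0 h_increasing h_limit_points
  h_continuous h_ninfty h_yinfty h_C1 lt ft.1.
pose w z := upper i0 x t z + c.
have mw : measurable_fun [set: 'rV[R]_d] w.
  by apply: measurable_funD => //; exact: measurable_upper.
have wle0 z : orthant R d z -> (h (w z)%:E <= h (w 0)%:E)%E.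
  move=> Oz; apply: transform_mono => //; rewrite lee_fin lerD2r.
  exact: (linearly_decreasing_le0 d_gt0 lt).
have mg : model_functions h (orthant_function w).
  apply: (@model_functions_orthant _ _ _ h_increasing w (fine (h (w 0)%:E))) => //.
    apply: orthant_function_convex => [z z' s /andP[s0 s1]|a].
      have : 0 <= s <= 1 by rewrite !ltW.
      by move=> /(upper_convex i0 x t z z'); rewrite /w; lra.
    rewrite (_ : [set _ | _] = [set z | a - c < upper i0 x t z]).
      exact: upper_gt_open.
    by apply/seteqP; split => z /=; rewrite ltrBlDr.
  by move=> z Oz; rewrite fineK ?wle0// transform_fin_num.
(* Raising by [c >= 0] keeps the values at the observations above [value t i]. *)
have le_t : likelihood h t <= sample_likelihood (orthant_function w).
  apply: ler_prod => i _; rewrite fine_ge0 ?transform_ge0//=.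
  rewrite orthant_functionE; last exact: x_orthant.
  have hwx : (h (w (x i))%:E < +oo)%E by exact: le_lt_trans (wle0 _ (x_orthant i)) hc.
  have vw : (h (value t i)%:E <= h (w (x i))%:E)%E.
    apply: transform_mono => //; rewrite lee_fin.
    by rewrite (le_trans (value_le_upper i0 x t i))// lerDl.
  by rewrite fine_le ?transform_fin_num// (le_lt_trans vw).
exists (orthant_function w); split => // g' mg'; apply: le_log_likelihood => //.
apply: le_trans le_t.
(* A competitor at least as likely as [g0] is replaced by its tangents, which are feasible; any
   other is beaten because [t] reaches the level of [g0]. *)
have [lg'|/ltW g'l] := leP (sample_likelihood g0) (sample_likelihood g').
  by have [t' ft' <-] := feasible_subgradients mg' lg'; exact: tmax.
by apply: le_trans g'l _; case: ft.
Qed.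

End maximum_likelihood.

Theorem theorem2p12 (R : realType) (d : nat) (d_ge1 : (1 <= d)%N)
    (h : \bar R -> \bar R)
    (h_increasing : increasing_transformation h)
    (h_limit_points : (y_zero h < y_infty h)%E)
    (h_continuous : continuous_at_limit_points h)
    (h_ninfty : exists2 alpha : R, d%:R < alpha &
       real_part h y / `|y| `^ (- alpha) @[y --> -oo_R] --> (0 : R))
    (h_yinfty : forall yi : R, y_infty h = yi%:E ->
       exists2 beta : R, d%:R < beta &
       asymp (yi^'-) (real_part h) (fun y => (yi - y) `^ (- beta)))
    (h_C1 : forall y : R, (y_zero h < y%:E < y_infty h)%E ->
       derivable (real_part h) y 1 /\
       {for y, continuous (derive1 (real_part h))})
    (disp : measure_display) (T : measurableType disp) (P : probability T R)
    (n : nat) (n_ge1 : (1 <= n)%N) (X : 'I_n -> {RV P >-> 'rV[R]_d})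
    (g0 : 'rV[R]_d -> \bar R) (g0_model : model_functions h g0)
    (X_iid : iid_with_density X (transformed h g0)) :
  {ae P, forall w, exists ghat : 'rV[R]_d -> \bar R,
     is_mle h (fun i => X i w) ghat}.
Proof.
have [gc0 [[mp _ _ _] _]] := g0_model.
(* Nonzero density will place each observation in the orthant, and nonzero coordinates then place it
   in the interior, where subgradients exist. *)
have g0_good i : {ae P, forall w, (forall j, X i w ord0 j != 0) /\
    transformed h g0 (X i w) != 0%E}.
  apply: (density_ae (X_iid.2 i) mp (B := [set x | forall j, x ord0 j != 0])).
  apply: filter_forall => j; have := @hyperplane_null R d j.
  apply: negligibleS => x /= /negP/negPn/eqP; exact.
have : {ae P, forall w i, (forall j, X i w ord0 j != 0) /\
    transformed h g0 (X i w) != 0%E} by exact: filter_forall.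
apply: filterS => w good.
have Ox i : orthant R d (X i w).
  apply: contrapT => Oi; have [_] := good i.
  by rewrite /transformed patchE memNset// eqxx.
have x_gt0 i j : 0 < X i w ord0 j.
  by rewrite lt_neqAle eq_sym (good i).1; exact: Ox.
apply: (mle_exists d_ge1 h_increasing h_limit_points h_continuous h_ninfty
  h_yinfty h_C1 (Ordinal n_ge1) x_gt0 g0_model) => i.
have [_] := good i; rewrite /transformed patchE mem_set//= => gi.
by rewrite lt_neqAle eq_sym gi transform_ge0.
Qed.
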